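(* Suppose $\alpha$ is $G$-basic, satisfies $d\alpha=0$, $d(J\alpha)=\omega_J$, $d(K\alpha)=\omega_K$ on $M$, and for every $Y\in\mathfrak g$ the functions $(J\alpha)(Y^* )$ and $(K\alpha)(Y^* )$ are constant when restricted to $\mu_G^{-1}(0)$. Then $\alpha$ naturally descends to a 1-form $\hat\alpha$ on the hyperkähler quotient $M/\!/G$ satisfying $$d\hat\alpha=0,\qquad d(\hat J\hat\alpha)=\hat\omega_J+F_1,\qquad d(\hat K\hat\alpha)=\hat\omega_K+F_2,$$ with $F_1$ and $F_2$ of type $(1,1)$ in each complex structure. Specifically, $$F_1=(J\alpha)_{\mathfrak g}\circ\Omega,\qquad F_2=(K\alpha)_{\mathfrak g}\circ\Omega .$$
   Context: $(M,g,I,J,K)$ is a hyperkähler manifold, $IJ=K$, $\omega_I=g(I\cdot,\cdot)$ etc.; for a 1-form, $(I\alpha)(v)=\alpha(Iv)$ etc. A Lie group $G$ with Lie algebra $\mathfrak g$ acts on $M$ preserving the hyperkähler structure and $\alpha$, with (equivariant) hyperkähler moment map $\mu_G=(\mu_I,\mu_J,\mu_K):M\to\mathfrak g^*\otimes\mathbb R^3$. For $Y\in\mathfrak g$, $Y^*$ is the action vector field, and $d\mu_I^Y=i_{Y^*}\omega_I$ etc., $\mu^Y(x)=\mu(x)(Y)$. $M/\!/G=\mu_G^{-1}(0)/G$ is the hyperkähler quotient at $0$ (as usual, assumed to be a smooth quotient, with $\mu_G^{-1}(0)\to M/\!/G$ a principal $G$-bundle), with induced structures $\hat I,\hat J,\hat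 K,\hat\omega_I,\hat\omega_J,\hat\omega_K$. ''$\alpha$ is $G$-basic'' means it is $G$-invariant and $\alpha(Y^* )=0$ for all $Y\in\mathfrak g$; $\hat\alpha$ is the form whose pullback to $\mu_G^{-1}(0)$ is the restriction of $\alpha$. The linear maps $(J\alpha)_{\mathfrak g},(K\alpha)_{\mathfrak g}:\mathfrak g\to\mathbb R$ are $Y\mapsto(J\alpha)(Y^* )$ and $Y\mapsto(K\alpha)(Y^* )$, evaluated on $\mu_G^{-1}(0)$. $\Omega$ is the $\mathfrak g$-valued curvature of the principal connection on $\mu_G^{-1}(0)\to M/\!/G$ whose horizontal spaces are the orthogonal complements of the $G$-orbits, with sign normalized so that $\Omega(v,w)\in\mathfrak g$ is the element whose action vector field is the vertical part of $[v^H,w^H]$, where $v^H,w^H$ are horizontal lifts; $F_1,F_2$ are regarded as forms on $M/\!/G$. *)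

(* Defs.v *)
From HB Require Import structures.
From mathcomp Require Import all_boot all_order all_algebra.
From mathcomp Require Import all_classical all_reals all_analysis.

Set Implicit Arguments.
Unset Strict Implicit.
Unset Printing Implicit Defensive.

Import Order.TTheory GRing.Theory Num.Theory.
Import numFieldNormedType.Exports.
Local Open Scope classical_set_scope.
Local Open Scope ring_scope.

(** Smooth manifolds on MathComp-Analysis.
    A manifold carries one chart around each of its points, and the tangent
    space at [p] is the model space ['rV_n], read in the chart at [p].  Tensor
    fields are therefore plain functions on points and row vectors, and "linear"
    and "smooth" are separate predicates. *)

(** * Smooth functions on open subsets of normed spaces *)

(* Intended for [U] open and [V] finite-dimensional, where continuity of all
   iterated directional derivatives of order at most [k] is the class C^k. *)
Fixpoint Ck (R : realType) (V W : normedModType R) (k : nat)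
    (U : set V) (f : V -> W) : Prop :=
  (forall x, U x -> {for x, continuous f}) /\
  (if k is k'.+1 then
     forall v, (forall x, U x -> derivable f x v) /\ Ck k' U (fun x => 'D_v f x)
   else True).

Definition smooth_on (R : realType) (V W : normedModType R)
    (U : set V) (f : V -> W) : Prop := forall k, Ck k U f.

(** * Manifolds and smooth maps *)

(* [mdom p], [mloc p] and [minv p] are the domain, the coordinate map and the
   inverse (total, meaningful on the image only) of the chart at [p]. *)
Record manifold (R : realType) (n : nat) := Manifold {
  mpoint :> topologicalType;
  mdom : mpoint -> set mpoint;
  mloc : mpoint -> mpoint -> 'rV[R]_n;
  minv : mpoint -> 'rV[R]_n -> mpoint;
  m_hausdorff : hausdorff_space mpoint;
  m_second_countable : @second_countable mpoint;
  mdom_center : forall p, mdom p p;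
  mdom_open : forall p, open (mdom p);
  mimg_open : forall p, open (mloc p @` mdom p);
  mlocK : forall p q, mdom p q -> minv p (mloc p q) = q;
  mloc_continuous : forall p q, mdom p q -> {for q, continuous (mloc p)};
  minv_continuous : forall p x,
    (mloc p @` mdom p) x -> {for x, continuous (minv p)};
  mtransition_smooth : forall p q,
    smooth_on [set x | (mloc p @` mdom p) x /\ mdom q (minv p x)]
              (mloc q \o minv p)
}.

Definition mimg (R : realType) n (M : manifold R n) (p : M) : set 'rV[R]_n :=
  mloc p @` mdom p.

Definition smooth_fun (R : realType) n (M : manifold R n) (f : M -> R) : Prop :=
  forall p, smooth_on (mimg p) (f \o minv p).

Definition smooth_map_on (R : realType) n m (M : manifold R n)
    (N : manifold R m) (O : set M) (f : M -> N) : Prop :=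
  (forall p, O p -> {for p, continuous f}) /\
  (forall p q, smooth_on
     [set x | [/\ mimg p x, O (minv p x) & mdom q (f (minv p x))]]
     (mloc q \o f \o minv p)).

Definition smooth_map (R : realType) n m (M : manifold R n)
    (N : manifold R m) (f : M -> N) : Prop := smooth_map_on setT f.

(* Smoothness of a map from the open subset [O * B] of the product [A * B], in
   product charts. *)
Definition smooth_map2_on (R : realType) n m l (A : manifold R n)
    (B : manifold R m) (C : manifold R l) (O : set A) (f : A -> B -> C) : Prop :=
  (forall z : A * B, O z.1 ->
     {for z, continuous (fun z : A * B => f z.1 z.2)}) /\
  (forall (a : A) (b : B) (c : C), smooth_on
     [set x : 'rV[R]_n * 'rV[R]_m |
       [/\ mimg a x.1, mimg b x.2, O (minv a x.1) &
           mdom c (f (minv a x.1) (minv b x.2))]]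
     (fun x : 'rV[R]_n * 'rV[R]_m => mloc c (f (minv a x.1) (minv b x.2)))).

Definition smooth_map2 (R : realType) n m l (A : manifold R n)
    (B : manifold R m) (C : manifold R l) (f : A -> B -> C) : Prop :=
  smooth_map2_on setT f.

(** * Tangent vectors and tensor fields *)

(* The tangent map T_p M -> T_(f p) N. *)
Definition tmap (R : realType) n m (M : manifold R n) (N : manifold R m)
    (f : M -> N) (p : M) (v : 'rV[R]_n) : 'rV[R]_m :=
  'D_v (mloc (f p) \o f \o minv p) (mloc p p).

Definition dfun (R : realType) n (M : manifold R n)
    (f : M -> R) (p : M) (v : 'rV[R]_n) : R :=
  'D_v (f \o minv p) (mloc p p).

(* The tangent vector at [minv p x] whose components in the chart at [p] are
   [u]; conversely, [coord p q w] are the components in the chart at [p] of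
   [w], a tangent vector at [q]. *)
Definition frame (R : realType) n (M : manifold R n) (p : M)
    (x u : 'rV[R]_n) : 'rV[R]_n :=
  'D_u (mloc (minv p x) \o minv p) x.

Definition coord (R : realType) n (M : manifold R n) (p q : M)
    (w : 'rV[R]_n) : 'rV[R]_n :=
  'D_w (mloc p \o minv q) (mloc q q).

Definition vfield (R : realType) n (M : manifold R n) := M -> 'rV[R]_n.
Definition endo (R : realType) n (M : manifold R n) := M -> 'rV[R]_n -> 'rV[R]_n.
Definition form1 (R : realType) n (M : manifold R n) := M -> 'rV[R]_n -> R.
Definition form2 (R : realType) n (M : manifold R n) :=
  M -> 'rV[R]_n -> 'rV[R]_n -> R.

(* The expression of a tensor field in the chart at [p]. *)
Definition vrep (R : realType) n (M : manifold R n) (X : vfield M) (p : M)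
    (x : 'rV[R]_n) : 'rV[R]_n :=
  coord p (minv p x) (X (minv p x)).

Definition erep (R : realType) n (M : manifold R n) (A : endo M) (p : M)
    (u x : 'rV[R]_n) : 'rV[R]_n :=
  coord p (minv p x) (A (minv p x) (frame p x u)).

Definition rep1 (R : realType) n (M : manifold R n) (a : form1 M) (p : M)
    (u x : 'rV[R]_n) : R :=
  a (minv p x) (frame p x u).

Definition rep2 (R : realType) n (M : manifold R n) (b : form2 M) (p : M)
    (u v x : 'rV[R]_n) : R :=
  b (minv p x) (frame p x u) (frame p x v).

Definition smooth_vfield_on (R : realType) n (M : manifold R n) (O : set M)
    (X : vfield M) : Prop :=
  forall p, smooth_on [set x | mimg p x /\ O (minv p x)] (vrep X p).

Definition is_endo (R : realType) n (M : manifold R n) (A : endo M) : Prop :=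
  (forall p, linear (A p)) /\ (forall p u, smooth_on (mimg p) (erep A p u)).

Definition is_form1 (R : realType) n (M : manifold R n) (a : form1 M) : Prop :=
  (forall p, scalar (a p)) /\ (forall p u, smooth_on (mimg p) (rep1 a p u)).

Definition is_bilinear_field (R : realType) n (M : manifold R n)
    (b : form2 M) : Prop :=
  [/\ forall p u, scalar (b p u),
      forall p v, scalar (fun u => b p u v) &
      forall p u v, smooth_on (mimg p) (rep2 b p u v)].

Definition is_form2 (R : realType) n (M : manifold R n) (b : form2 M) : Prop :=
  is_bilinear_field b /\ (forall p u, b p u u = 0).

Definition is_metric (R : realType) n (M : manifold R n) (g : form2 M) : Prop :=
  [/\ is_bilinear_field g,
      forall p u v, g p u v = g p v u &
      forall p u, u != 0 -> 0 < g p u u].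

(* (d a)(u, v) = u(a(v)) - v(a(u)) - a([u, v]), for the coordinate-constant
   extensions of u and v in the chart at [p]. *)
Definition dform (R : realType) n (M : manifold R n) (a : form1 M) : form2 M :=
  fun p u v => 'D_u (rep1 a p v) (mloc p p) - 'D_v (rep1 a p u) (mloc p p).

Definition lie_bracket (R : realType) n (M : manifold R n) (X Y : vfield M) :
    vfield M :=
  fun p => 'D_(X p) (vrep Y p) (mloc p p) - 'D_(Y p) (vrep X p) (mloc p p).

Definition pullback1 (R : realType) n m (M : manifold R n) (N : manifold R m)
    (f : M -> N) (a : form1 N) : form1 M :=
  fun p u => a (f p) (tmap f p u).

Definition pullback2 (R : realType) n m (M : manifold R n) (N : manifold R m)
    (f : M -> N) (b : form2 N) : form2 M :=
  fun p u v => b (f p) (tmap f p u) (tmap f p v).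

(** * Hyperkähler structures *)

(* [Gam] gives the Levi-Civita Christoffel symbols at [p] in the chart at [p]:
   nabla_w u = d_w u + Gam w u. *)
Definition levi_civita_at (R : realType) n (M : manifold R n) (g : form2 M)
    (p : M) (Gam : 'rV[R]_n -> 'rV[R]_n -> 'rV[R]_n) : Prop :=
  [/\ forall w, linear (Gam w),
      forall w u, Gam w u = Gam u w &
      forall w u v, 'D_w (rep2 g p u v) (mloc p p) =
                    g p (Gam w u) v + g p u (Gam w v)].

Definition parallel_at (R : realType) n (M : manifold R n) (A : endo M) (p : M)
    (Gam : 'rV[R]_n -> 'rV[R]_n -> 'rV[R]_n) : Prop :=
  forall w u, 'D_w (erep A p u) (mloc p p) + Gam w (A p u) - A p (Gam w u) = 0.

Definition almost_hermitian (R : realType) n (M : manifold R n) (g : form2 M)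
    (A : endo M) : Prop :=
  [/\ is_endo A,
      forall p u, A p (A p u) = - u &
      forall p u v, g p (A p u) (A p v) = g p u v].

Record hyperkahler (R : realType) n (M : manifold R n) (g : form2 M)
    (I J K : endo M) : Prop := Hyperkahler {
  hk_metric : is_metric g;
  hk_I : almost_hermitian g I;
  hk_J : almost_hermitian g J;
  hk_K : almost_hermitian g K;
  hk_IJ : forall p u, I p (J p u) = K p u;
  hk_parallel : forall p, exists Gam, levi_civita_at g p Gam /\
    [/\ parallel_at I p Gam, parallel_at J p Gam & parallel_at K p Gam]
}.

(* omega_A = g(A., .) *)
Definition kahler_form (R : realType) n (M : manifold R n) (g : form2 M)
    (A : endo M) : form2 M := fun p u v => g p (A p u) v.

(* (A a)(v) = a(A v) *)
Definition endo_form1 (R : realType) n (M : manifold R n) (A : endo M)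
    (a : form1 M) : form1 M := fun p v => a p (A p v).

(* [z] stands for the complexified tangent vector z.1 + i z.2. *)
Definition holo_vector (R : realType) n (M : manifold R n) (A : endo M) (p : M)
    (z : 'rV[R]_n * 'rV[R]_n) : Prop :=
  A p z.1 = - z.2 /\ A p z.2 = z.1.

Definition antiholo_vector (R : realType) n (M : manifold R n) (A : endo M)
    (p : M) (z : 'rV[R]_n * 'rV[R]_n) : Prop :=
  A p z.1 = z.2 /\ A p z.2 = - z.1.

(* Real and imaginary parts of the complex-bilinear extension of [F]. *)
Definition complexify2 (R : realType) n (M : manifold R n) (F : form2 M) (p : M)
    (z w : 'rV[R]_n * 'rV[R]_n) : R * R :=
  (F p z.1 w.1 - F p z.2 w.2, F p z.1 w.2 + F p z.2 w.1).

(* The (2,0) and (0,2) components of [F] vanish. *)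
Definition type11 (R : realType) n (M : manifold R n) (A : endo M)
    (F : form2 M) : Prop :=
  forall p z w,
    (holo_vector A p z /\ holo_vector A p w) \/
    (antiholo_vector A p z /\ antiholo_vector A p w) ->
    complexify2 F p z w = (0, 0).

(** * Lie groups and actions *)

Record lie_group (R : realType) (k : nat) := LieGroup {
  lmanifold :> manifold R k;
  lmul : lmanifold -> lmanifold -> lmanifold;
  linv : lmanifold -> lmanifold;
  lone : lmanifold;
  lmulA : associative lmul;
  lmul1g : left_id lone lmul;
  lmulVg : left_inverse lone linv lmul;
  lmul_smooth : smooth_map2 lmul;
  linv_smooth : smooth_map linv
}.

Arguments lone {R k} G : rename.

(* The Lie algebra is the tangent space at [lone G]. *)
Definition Ad (R : realType) k (G : lie_group R k) (a : G) (Y : 'rV[R]_k) :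
    'rV[R]_k :=
  tmap (fun h : G => lmul (lmul a h) (linv a)) (lone G) Y.

Record smooth_action (R : realType) k n (G : lie_group R k) (M : manifold R n)
    (act : G -> M -> M) : Prop := SmoothAction {
  act_one : forall p, act (lone G) p = p;
  act_mul : forall a b p, act (lmul a b) p = act a (act b p);
  act_smooth : smooth_map2 act
}.

(* Y^*_p is the velocity at time 0 of exp(tY).p, i.e. the image of [Y] under
   the tangent map at the identity of the orbit map of [p]. *)
Definition action_field (R : realType) k n (G : lie_group R k)
    (M : manifold R n) (act : G -> M -> M) (Y : 'rV[R]_k) : vfield M :=
  fun p => tmap (fun a : G => act a p) (lone G) Y.

Definition invariant_form1 (R : realType) k n (G : lie_group R k)
    (M : manifold R n) (act : G -> M -> M) (a : form1 M) : Prop :=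
  forall h p v, pullback1 (act h) a p v = a p v.

Definition invariant_form2 (R : realType) k n (G : lie_group R k)
    (M : manifold R n) (act : G -> M -> M) (b : form2 M) : Prop :=
  forall h p u v, pullback2 (act h) b p u v = b p u v.

Definition invariant_endo (R : realType) k n (G : lie_group R k)
    (M : manifold R n) (act : G -> M -> M) (A : endo M) : Prop :=
  forall h p u, tmap (act h) p (A p u) = A (act h p) (tmap (act h) p u).

Definition basic_form1 (R : realType) k n (G : lie_group R k)
    (M : manifold R n) (act : G -> M -> M) (a : form1 M) : Prop :=
  invariant_form1 act a /\ (forall Y p, a p (action_field act Y p) = 0).

(* One component M -> g^* of the hyperkähler moment map, for the coadjoint
   action on g^*. *)
Record moment_map (R : realType) k n (G : lie_group R k) (M : manifold R n)
    (act : G -> M -> M) (omega : form2 M) (mu : M -> 'rV[R]_k -> R) : Prop :=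
  MomentMap {
  mu_linear : forall p, scalar (mu p);
  mu_smooth : forall Y, smooth_fun (fun p => mu p Y);
  mu_hamiltonian : forall Y p v,
    dfun (fun q => mu q Y) p v = omega p (action_field act Y p) v;
  mu_equivariant : forall a p Y, mu (act a p) Y = mu p (Ad (linv a) Y)
}.

(** * Hyperkähler quotients *)

Record embedding_onto (R : realType) m n (N : manifold R m) (M : manifold R n)
    (iota : N -> M) (S : set M) : Prop := EmbeddingOnto {
  emb_smooth : smooth_map iota;
  emb_injective : injective iota;
  emb_immersion : forall p, injective (tmap iota p);
  emb_topology : forall U : set N, open U ->
    exists2 V : set M, open V & U = iota @^-1` V;
  emb_image : range iota = S
}.

(* A local trivialization over [U] is given as p |-> (pi p, tau p), with
   inverse [Phi]; the structure group acts on the left. *)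
Record principal_bundle (R : realType) k m l (G : lie_group R k)
    (N : manifold R m) (Q : manifold R l) (act : G -> N -> N) (pi : N -> Q) :
    Prop := PrincipalBundle {
  pb_action : smooth_action act;
  pb_smooth : smooth_map pi;
  pb_surjective : forall q, exists p, pi p = q;
  pb_orbits : forall p p', pi p = pi p' <-> exists a, p' = act a p;
  pb_trivial : forall q, exists (U : set Q) (tau : N -> G) (Phi : Q -> G -> N),
    [/\ open U, U q,
        smooth_map_on (pi @^-1` U) tau & smooth_map2_on U Phi] /\
    [/\ forall u a, U u -> pi (Phi u a) = u /\ tau (Phi u a) = a,
        forall p, U (pi p) -> Phi (pi p) (tau p) = p &
        forall a p, U (pi p) -> tau (act a p) = lmul a (tau p)]
}.

(* Orthogonality to the orbit through [p], for a metric [gN] on the total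
   space. *)
Definition horizontal (R : realType) k m (G : lie_group R k) (N : manifold R m)
    (act : G -> N -> N) (gN : form2 N) (p : N) (v : 'rV[R]_m) : Prop :=
  forall Y, gN p v (action_field act Y p) = 0.

Definition hlift (R : realType) k m l (G : lie_group R k) (N : manifold R m)
    (Q : manifold R l) (act : G -> N -> N) (pi : N -> Q) (gN : form2 N)
    (p : N) (u : 'rV[R]_l) : 'rV[R]_m :=
  xget 0 [set v | horizontal act gN p v /\ tmap pi p v = u].

Definition hlift_field (R : realType) k m l (G : lie_group R k)
    (N : manifold R m) (Q : manifold R l) (act : G -> N -> N) (pi : N -> Q)
    (gN : form2 N) (X : vfield Q) : vfield N :=
  fun p => hlift act pi gN p (X (pi p)).

(* Omega_p(u, w), for u and w tangent to [Q] at [pi p], is the element of the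
   Lie algebra whose action vector field is at [p] the vertical part of
   [U^H, W^H], for all local vector fields U, W on Q extending u, w. *)
Definition curvature (R : realType) k m l (G : lie_group R k)
    (N : manifold R m) (Q : manifold R l) (act : G -> N -> N) (pi : N -> Q)
    (gN : form2 N) (p : N) (u w : 'rV[R]_l) : 'rV[R]_k :=
  xget 0 [set Y | forall (O : set Q) (U W : vfield Q),
    open O -> O (pi p) -> smooth_vfield_on O U -> smooth_vfield_on O W ->
    U (pi p) = u -> W (pi p) = w ->
    horizontal act gN p
      (lie_bracket (hlift_field act pi gN U) (hlift_field act pi gN W) p
       - action_field act Y p)].

(* The complex structure on the quotient acts on horizontal lifts as [A], and
   the metric is that of the horizontal lifts. *)
Definition induced_endo (R : realType) k n m l (G : lie_group R k)
    (M : manifold R n) (N : manifold R m) (Q : manifold R l) (iota : N -> M)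
    (act : G -> N -> N) (pi : N -> Q) (gN : form2 N) (A : endo M)
    (Ah : endo Q) : Prop :=
  forall p u, tmap iota p (hlift act pi gN p (Ah (pi p) u)) =
              A (iota p) (tmap iota p (hlift act pi gN p u)).

Definition induced_metric (R : realType) k m l (G : lie_group R k)
    (N : manifold R m) (Q : manifold R l)
    (act : G -> N -> N) (pi : N -> Q) (gN : form2 N) (gh : form2 Q) : Prop :=
  forall p u v, gh (pi p) u v =
                gN p (hlift act pi gN p u) (hlift act pi gN p v).

(* [Q] is the hyperkähler quotient at 0: [N], embedded by [iota], is the zero
   level set, [actN] the restricted action, [pi] the quotient map, and
   [gh], [Ih], [Jh], [Kh] the induced structures. *)
Record hyperkahler_quotient (R : realType) k n m l (G : lie_group R k)
    (M : manifold R n) (N : manifold R m) (Q : manifold R l)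
    (g : form2 M) (I J K : endo M) (act : G -> M -> M)
    (muI muJ muK : M -> 'rV[R]_k -> R)
    (iota : N -> M) (actN : G -> N -> N) (pi : N -> Q)
    (gh : form2 Q) (Ih Jh Kh : endo Q) : Prop := HyperkahlerQuotient {
  hq_level : embedding_onto iota
    [set p | forall Y, [/\ muI p Y = 0, muJ p Y = 0 & muK p Y = 0]];
  hq_act : forall a p, iota (actN a p) = act a (iota p);
  hq_bundle : principal_bundle actN pi;
  hq_tensors : [/\ is_metric gh, is_endo Ih, is_endo Jh & is_endo Kh];
  hq_metric : induced_metric actN pi (pullback2 iota g) gh;
  hq_I : induced_endo iota actN pi (pullback2 iota g) I Ih;
  hq_J : induced_endo iota actN pi (pullback2 iota g) J Jh;
  hq_K : induced_endo iota actN pi (pullback2 iota g) K Kh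
}.

(* Main.v *)
Require Import Defs.
From HB Require Import structures.
From mathcomp Require Import all_boot all_order all_algebra.
From mathcomp Require Import all_classical all_reals all_analysis.
From mathcomp Require Import ring lra.

(** Write [iota] for the inclusion of the zero level N in M, [pi] for the
    projection onto the quotient Q, u^H for the horizontal lift of u, and Y^#
    for the action field of Y.

    A basic closed form alpha descends because two lifts to N of a tangent
    vector of Q differ by a group element and a vertical vector
    ([descended_formE]); alphah is smooth because [pi] has local sections, and
    closed because d commutes with pullback and [pi] is a submersion.

    Let A be J or K, and Ah the structure induced on Q.  Since A u^H lifts
    Ah u, the pullback of Ah alphah by [pi] takes on v the value of A alpha on
    the horizontal part of v.  So it agrees along horizontal fields with the
    restriction of A alpha to N, and by Cartan's formula ([dform_vfields]) the
    exterior derivatives of the two on (u^H, w^H) differ by the value of A alpha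
    on the vertical part of [U^H, W^H], that is on Omega(u, w)^#.  The
    hypothesis on action fields turns this into alpha_g(Omega(u, w))
    ([curvature_formE]); the derivative of the restriction of A alpha gives the
    Kaehler form.

    The type (1,1) property is a property of Omega.  The metric dual eta of
    Y^# equals I d mu_I, J d mu_J and K d mu_K, where each mu is evaluated at Y
    ([moment_orbit_form]).  For a parallel complex structure A, the form
    d(A d mu) is A-invariant because the Hessian of mu is symmetric
    ([d_endo_dfun_type11]); hence d eta is invariant under I, J and K.  Cartan's
    formula on N gives g(Omega(u, w)^#, Y^#) = - d eta (u^H, w^H)
    ([curvature_orbit_form]), so Omega is invariant too.  The same computation
    shows that the vertical part of [U^H, W^H] at a point depends only on the
    values of U and W there, so that the curvature is well defined.

    Everything rests on calculus for maps whose smoothness is expressed by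
    directional derivatives: continuous partial derivatives give Frechet
    differentiability ([differentiable_of_continuous_partials]), mixed
    derivatives commute ([schwarz]), and so d is compatible with smooth maps
    ([coord_d_pullback]).  Horizontal lifts are differentiable because in a
    chart they solve a linear system with smooth coefficients
    ([differentiable_linear_system], [differentiable_hlift_field]). *)

Set Implicit Arguments.
Unset Strict Implicit.
Unset Printing Implicit Defensive.

Import Order.TTheory GRing.Theory Num.Theory.
Import numFieldNormedType.Exports.
Local Open Scope classical_set_scope.
Local Open Scope ring_scope.

(** * Frechet differentiability from directional derivatives *)

Section DirectionalDerivatives.
Context {R : realType}.
Implicit Types V W : normedModType R.

Lemma growth_line V W (f : V -> W) (x v : V) (t : R) :
  (fun h : R => h^-1 *: (((fun s : R => f (s *: v + x)) \o shift t) (h *: 1)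
     - f (t *: v + x))) =
  (fun h : R => h^-1 *: ((f \o shift (t *: v + x)) (h *: v)
     - f (t *: v + x))).
Proof.
by apply/funext => h /=; rewrite scalerDl addrA [h *: 1]mulr1.
Qed.

Lemma is_derive_line V W (f : V -> W) (x v : V) (t : R) :
  derivable f (t *: v + x) v ->
  is_derive t (1 : R) (fun s : R => f (s *: v + x)) ('D_v f (t *: v + x)).
Proof.
by move=> df; split; rewrite /derivable /derive growth_line.
Qed.

(** The one-variable mean value theorem on the segment from [x] to
    [v + x]. *)
Lemma directional_MVT V (f : V -> R) (x v : V) :
  (forall t, t \in `[0, 1] -> derivable f (t *: v + x) v) ->
  exists2 t, t \in `]0, 1[ & f (v + x) - f x = 'D_v f (t *: v + x).
Proof.
move=> df.
have [|||t t01] := @MVT R (fun s : R => f (s *: v + x))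
  (fun s => 'D_v f (s *: v + x)) 0 1.
- exact: ltr01.
- move=> s s01; apply: is_derive_line; apply: df.
  by move: s01; rewrite !in_itv /= => /andP[/ltW -> /ltW ->].
- apply: derivable_within_continuous => s s01.
  by have [] := is_derive_line (df s s01).
- by rewrite scale1r scale0r add0r subr0 mulr1 => e; exists t.
Qed.

(** Rescaling the parameter of a line is all that this needs; additivity in the
    direction is only available at points of differentiability. *)
Lemma derivable_scale V W (f : V -> W) (x v : V) (a : R) :
  derivable f x v -> is_derive x (a *: v) f (a *: 'D_v f x).
Proof.
move=> df.
have df0 : derivable f (0 *: v + x) v by rewrite scale0r add0r.
have [d0 e0] := is_derive_line df0.
have la : differentiable (fun s : R => a * s : R) 0.
  exact: (@differentiableZ _ _ _ id a 0).
have dphi : differentiable (fun s : R => f (s *: v + x)) ((fun s : R => a * s) 0).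
  by rewrite /= mulr0; apply/derivable1_diffP.
have dc : differentiable ((fun s : R => f (s *: v + x)) \o (fun s : R => a * s)) 0.
  exact: differentiable_comp.
have E : (fun s : R => f (s *: v + x)) \o (fun s : R => a * s) =
         (fun s : R => f (s *: (a *: v) + x)).
  by apply/funext => s /=; rewrite scalerA mulrC.
split.
  apply/derivable1P/derivable1_diffP.
  by rewrite -E.
have -> : 'D_(a *: v) f x = 'D_1 (fun s : R => f (s *: (a *: v) + x)) 0.
  by rewrite /derive growth_line scale0r add0r.
rewrite -E deriveE // diff_comp //=.
have -> : 'd (fun s : R => a * s : R) 0 1 = a *: (1 : R).
  have := @diffZ _ _ _ id a (0 : R) => H.
  rewrite (_ : (fun s : R => a * s) = a \*: id)%R //.
  by rewrite H // diff_val /=.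
rewrite linearZ /= mulr0 -deriveE; last by apply/derivable1_diffP.
by rewrite e0 scale0r add0r.
Qed.

End DirectionalDerivatives.

Section Differentiability.
Context {R : realType}.

Lemma rV_norm_le n (a b : 'rV[R]_n) :
  (forall i, `|a 0 i| <= `|b 0 i|) -> `|a| <= `|b|.
Proof.
move=> ab; rewrite [leLHS]/Num.Def.normr /= mx_normrE bigmax_le //= => -[i j] _.
rewrite ord1 (le_trans (ab j)) // [leRHS]/Num.Def.normr /= mx_normrE.
exact: (le_bigmax _ (fun ij : 'I_1 * 'I_n => `|b ij.1 ij.2|) (ord0, j)).
Qed.

Lemma rV_coord_le n (a : 'rV[R]_n) i : `|a 0 i| <= `|a|.
Proof.
rewrite [leRHS]/Num.Def.normr /= mx_normrE.
exact: (le_bigmax _ (fun ij : 'I_1 * 'I_n => `|a ij.1 ij.2|) (ord0, i)).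
Qed.

Lemma differentiable_linear_approx (V W : normedModType R) (f : V -> W)
    (df : {linear V -> W}) (x : V) : continuous df ->
  (forall e, 0 < e ->
     \forall h \near 0, `|f (h + x) - f x - df h| <= e * `|h|) ->
  differentiable f x.
Proof.
move=> cdf H.
have key : f \o shift x = cst (f x) + df +o_ 0 id.
  apply/eqaddoP => e /H; apply: filterS => h.
  by rewrite opprD addrA.
have dfE := diff_unique cdf key.
by apply/diff_locallyP; rewrite dfE.
Qed.

Definition partial_lin n (c : 'I_n -> R) (h : 'rV[R]_n) : R :=
  \sum_i h 0 i * c i.

Lemma partial_lin_is_linear n (c : 'I_n -> R) : scalar (partial_lin c).
Proof.
move=> a u v; rewrite /partial_lin /= mulr_sumr -big_split /=.
by apply: eq_bigr => i _; rewrite !mxE mulrDl mulrA.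
Qed.

HB.instance Definition _ n c := GRing.isLinear.Build R _ _ _ (@partial_lin n c)
  (@partial_lin_is_linear n c).

Lemma partial_lin_continuous n (c : 'I_n -> R) : continuous (partial_lin c).
Proof.
apply: continuous_big => [|i _ h]; first exact: add_continuous.
by have H := @coord_continuous R 1 n 0 i h; exact: (cvgMr_tmp H).
Qed.

(** The corners of the staircase path from 0 to [h] along the coordinate
    directions. *)
Let trunc n (h : 'rV[R]_n) j : 'rV[R]_n := \row_i (if (i < j)%N then h 0 i else 0).

(** The increment [f (h + x) - f x] telescopes along a staircase path.  By the
    mean value theorem each step is a coordinate of [h] times a partial
    derivative taken close to [x], and continuity compares it with the one at
    [x]. *)
Lemma differentiable_of_continuous_partials n (f : 'rV[R]_n -> R) (x : 'rV[R]_n) :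
  (\forall y \near x, forall i, derivable f y (delta_mx 0 i)) ->
  (forall i, {for x, continuous (fun y => 'D_(delta_mx 0 i) f y)}) ->
  differentiable f x.
Proof.
move=> df cf; set c : 'I_n -> R := fun i => 'D_(delta_mx 0 i) f x.
apply: (@differentiable_linear_approx _ _ f (partial_lin c)).
  exact: partial_lin_continuous.
move=> e e0.
  (* Each of the [n] steps may cost [e']; the successor avoids [n = 0]. *)
  pose e' := e / n.+1%:R.
  have e'0 : 0 < e' by rewrite divr_gt0.
  have [d /= d0 H] : exists2 d : R, 0 < d & forall y, `|y| < d -> forall i,
      derivable f (y + x) (delta_mx 0 i) /\
      `|'D_(delta_mx 0 i) f (y + x) - c i| <= e'.
    have : \forall y \near x, (forall i, derivable f y (delta_mx 0 i)) /\
        forall i, `|'D_(delta_mx 0 i) f y - c i| <= e'.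
      apply: filterI => //.
      apply: (@filter_forall _ _ (fun i y => `|'D_(delta_mx 0 i) f y - c i| <= e')
        (nbhs x)) => i.
      have /cvgrPdist_le /(_ _ e'0) := cf i.
      by apply: filterS => y; rewrite distrC.
    move=> /nbhs_normP[d /= d0 H]; exists d => // y yd i.
    have [] := H (y + x); first by rewrite /ball_ /= opprD addrCA subrr addr0 normrN.
    by move=> H1 H2; split.
  apply/nbhs_normP; exists d => //= h; rewrite /ball_ /= sub0r normrN => hd.
  have T0 : trunc h 0 = 0 by apply/rowP => i; rewrite !mxE.
  have Tn : trunc h n = h by apply/rowP => i; rewrite !mxE ltn_ord.
  have TS (j : 'I_n) : trunc h j.+1 = h 0 j *: delta_mx 0 j + trunc h j.
    apply/rowP => i; rewrite !mxE eqxx /= ltnS leq_eqVlt.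
    have [/val_inj ->|ne] := eqVneq (i : nat) j.
      by rewrite eqxx ltnn mulr1 addr0.
    by rewrite (_ : i == j = false) ?mulr0 ?add0r //; apply/negbTE.
  have -> : f (h + x) - f x = \sum_(j < n) (f (trunc h j.+1 + x) - f (trunc h j + x)).
    rewrite -(big_mkord predT (fun j => f (trunc h j.+1 + x) - f (trunc h j + x))).
    by rewrite telescope_sumr // T0 Tn add0r.
  rewrite /partial_lin -sumrB.
  have step (j : 'I_n) :
      `|f (trunc h j.+1 + x) - f (trunc h j + x) - h 0 j * c j| <= e' * `|h|.
    have small t : t \in `[0, 1] ->
        `|t *: (h 0 j *: delta_mx 0 j) + trunc h j| < d.
      rewrite in_itv /= => /andP[t0 t1]; apply: le_lt_trans hd.
      apply: rV_norm_le => i; rewrite !mxE eqxx /=.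
      have [->|ne] := eqVneq i j.
        by rewrite ltnn mulr1 addr0 normrM ger0_norm // ler_piMl.
      by rewrite !mulr0 add0r; case: ifP; rewrite ?normr0.
    have dd t : t \in `[0, 1] ->
        is_derive (t *: (h 0 j *: delta_mx 0 j) + (trunc h j + x))
          (h 0 j *: delta_mx 0 j) f
          (h 0 j *: 'D_(delta_mx 0 j) f (t *: (h 0 j *: delta_mx 0 j) + (trunc h j + x))).
      move=> t01; apply: derivable_scale; rewrite addrA.
      by have [] := H _ (small t t01) j.
    have [|t t01] := @directional_MVT R _ f (trunc h j + x) (h 0 j *: delta_mx 0 j).
      by move=> t /dd[].
    have t01' : t \in `[0, 1].
      by move: t01; rewrite !in_itv /= => /andP[/ltW -> /ltW ->].
    rewrite addrA -TS => ->; have [_ ->] := dd t t01'.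
    rewrite -[_ *: _]/(_ * _) -mulrBr normrM mulrC.
    apply: ler_pM => //; last exact: rV_coord_le.
    by rewrite addrA; have [] := H _ (small t t01') j.
  apply: (le_trans (ler_norm_sum _ _ _)).
  apply: (@le_trans _ _ (\sum_(j < n) e' * `|h|)); first exact: ler_sum.
  rewrite sumr_const card_ord -mulrnAl ler_wpM2r // /e' -mulr_natr.
  by rewrite mulrAC ler_pdivrMr // ler_pM2l // ler_nat leqnSn.
Qed.

End Differentiability.

(** * The chain rule and maps of class C^k *)

Section Chain.
Context {R : realType}.
Implicit Types V W Z : normedModType R.

(** Along the line through [x] the inner map is a differentiable function of
    one real variable, so that only [g] has to be Frechet differentiable and
    [V] may be any normed space. *)
Lemma is_derive_comp V W Z (f : V -> W) (g : W -> Z) (x v : V) :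
  derivable f x v -> differentiable g (f x) ->
  is_derive x v (g \o f) ('D_('D_v f x) g (f x)).
Proof.
move=> df dg.
have df0 : derivable f (0 *: v + x) v by rewrite scale0r add0r.
have [d0 e0] := is_derive_line df0.
set phi := fun s : R => f (s *: v + x) in d0 e0.
have phi0 : phi 0 = f x by rewrite /phi scale0r add0r.
have dphi : differentiable phi 0 by apply/derivable1_diffP.
have dg0 : differentiable g (phi 0) by rewrite phi0.
have dc : differentiable (g \o phi) 0 by exact: differentiable_comp.
split; first by apply/derivable1P/derivable1_diffP.
have -> : 'D_v (g \o f) x = 'D_1 (g \o phi) 0.
  by rewrite /derive (growth_line (g \o f) x v 0) scale0r add0r.
rewrite deriveE // diff_comp //= -deriveE // -deriveE // phi0.
by rewrite e0 scale0r add0r.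
Qed.

Lemma cvg_rV (T : Type) (F : set_system T) {FF : Filter F} n (f : T -> 'rV[R]_n)
    (y : 'rV[R]_n) :
  (forall i, f t 0 i @[t --> F] --> y 0 i) -> f @ F --> y.
Proof.
move=> H; apply/cvgrPdist_le => e e0.
have : \forall t \near F, forall i, `|y 0 i - f t 0 i| <= e.
  apply: (@filter_forall _ _ (fun i t => `|y 0 i - f t 0 i| <= e) F) => i.
  by have /cvgrPdist_le /(_ _ e0) := H i.
apply: filterS => t Ht.
rewrite [leLHS]/Num.Def.normr /= mx_normrE bigmax_le ?ltW //= => -[i j] _.
by rewrite ord1 !mxE Ht.
Qed.

Lemma derive_coord V n (f : V -> 'rV[R]_n) (x v : V) i : derivable f x v ->
  'D_v (fun y => f y 0 i) x = 'D_v f x 0 i.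
Proof. by move=> df; rewrite derive_mx // mxE. Qed.

Lemma differentiable_rV V n (f : V -> 'rV[R]_n) (x : V) :
  (forall i, differentiable (fun y => f y 0 i) x) -> differentiable f x.
Proof.
move=> df.
have -> : f = (fun y => \sum_(i < n) (f y 0 i *: (delta_mx 0 i : 'rV[R]_n))).
  by apply/funext => y; rewrite -row_sum_delta.
have -> : (fun y => \sum_(i < n) (f y 0 i *: (delta_mx 0 i : 'rV[R]_n))) =
  \sum_(i < n) (fun y => f y 0 i *: (delta_mx 0 i : 'rV[R]_n)).
  by apply/funext => y; rewrite fct_sumE.
by apply: differentiable_sum => i; apply: differentiableZl.
Qed.

Lemma derive_sum_delta n W (g : 'rV[R]_n -> W) (x u : 'rV[R]_n) :
  differentiable g x ->
  'D_u g x = \sum_i u 0 i *: 'D_(delta_mx 0 i) g x.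
Proof.
move=> dg; rewrite deriveE // {1}[u]row_sum_delta linear_sum.
by apply: eq_bigr => i _; rewrite linearZ deriveE.
Qed.

End Chain.

Section Ck.
Context {R : realType}.
Implicit Types V W : normedModType R.

Lemma Ck_sub V W k (U U' : set V) (f : V -> W) :
  U' `<=` U -> Ck k U f -> Ck k U' f.
Proof.
move=> UU'; elim: k f => [|k IH] f [cf Hf]; split=> //.
- by move=> x /UU' /cf.
- by move=> x /UU' /cf.
- move=> v; have [df Dk] := Hf v; split; last exact: IH.
  by move=> x /UU' /df.
Qed.

Lemma Ck_S V W k (U : set V) (f : V -> W) : Ck k.+1 U f -> Ck k U f.
Proof.
elim: k f => [|k IH] f [cf Hf]; split=> //.
by move=> v; have [df Dk] := Hf v; split => //; exact: IH.
Qed.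

(** Every clause of [Ck] is about germs at points of [U], so the sets [B]
    need not even be open. *)
Lemma Ck_local V W k (U : set V) (f : V -> W) :
  (forall x, U x -> exists2 B, B x & Ck k B f) -> Ck k U f.
Proof.
elim: k f => [|k IH] f H; split=> //.
- by move=> x /H[B Bx [cf _]]; exact: cf.
- by move=> x /H[B Bx [cf _]]; exact: cf.
- move=> v; split.
    by move=> x /H[B Bx [_ /(_ v)[df _]]]; exact: df.
  by apply: IH => x /H[B Bx [_ /(_ v)[_ Hk]]]; exists B.
Qed.

Lemma Ck_eq V W k (U : set V) (f g : V -> W) : open U ->
  (forall x, U x -> f x = g x) -> Ck k U f -> Ck k U g.
Proof.
move=> oU; elim: k f g => [|k IH] f g fg [cf Hf].
  split=> // x Ux; have nfg : {near x, f =1 g}.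
    by apply: filterS (open_nbhs_nbhs (conj oU Ux)) => y /fg.
  rewrite /prop_for /continuous_at -(fg x Ux).
  by apply: cvg_trans (cf x Ux); apply: near_eq_cvg.
have nfg x : U x -> {near x, f =1 g}.
  by move=> Ux; apply: filterS (open_nbhs_nbhs (conj oU Ux)) => y /fg.
split=> [x Ux|v].
  rewrite /prop_for /continuous_at -(fg x Ux).
  by apply: cvg_trans (cf x Ux); apply: near_eq_cvg; exact: nfg.
have [df Dk] := Hf v; split=> [x Ux|].
  by apply: near_eq_derivable (df x Ux); exact: nfg.
apply: IH Dk => x Ux; apply: near_eq_derive.
exact: nfg.
Qed.

Lemma Ck_cst V W k (U : set V) (w : W) : Ck k U (fun _ => w).
Proof.
elim: k w => [|k IH] w; first by split=> // x _; exact: cvg_cst.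
split=> [x _|v]; first exact: cvg_cst.
split=> [x _|]; first exact: derivable_cst.
  rewrite (_ : (fun x => 'D_v (fun _ : V => w) x) = (fun=> 0)) //.
  by apply/funext => x; rewrite derive_cst.
Qed.

Lemma CkD V W k (U : set V) (f g : V -> W) : open U ->
  Ck k U f -> Ck k U g -> Ck k U (fun x => f x + g x).
Proof.
move=> oU; elim: k f g => [|k IH] f g [cf Hf] [cg Hg].
  by split=> // x Ux; apply: cvgD; [exact: cf | exact: cg].
split=> [x Ux|v]; first by apply: cvgD; [exact: cf | exact: cg].
have [df Df] := Hf v; have [dg Dg] := Hg v; split=> [x Ux|].
    by apply: derivableD; [exact: df | exact: dg].
  apply: Ck_eq (IH _ _ Df Dg) => // x Ux.
  by rewrite [RHS]deriveD //; [exact: df | exact: dg].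
Qed.

Lemma CkM V k (U : set V) (f g : V -> R) : open U ->
  Ck k U f -> Ck k U g -> Ck k U (fun x => f x * g x).
Proof.
move=> oU; elim: k f g => [|k IH] f g Cf Cg.
  have [cf _] := Cf; have [cg _] := Cg.
  by split=> // x Ux; apply: cvgM; [exact: cf | exact: cg].
have [cf Hf] := Cf; have [cg Hg] := Cg.
split=> [x Ux|v]; first by apply: cvgM; [exact: cf | exact: cg].
have [df Df] := Hf v; have [dg Dg] := Hg v; split=> [x Ux|].
  by apply: derivableM; [exact: df | exact: dg].
apply: Ck_eq (CkD oU (IH _ _ (Ck_S Cf) Dg) (IH _ _ (Ck_S Cg) Df)) => // x Ux.
by rewrite [RHS]deriveM //; [exact: df | exact: dg].
Qed.

Lemma Ck_sum V W k (U : set V) n (f : 'I_n -> V -> W) : open U ->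
  (forall i, Ck k U (f i)) -> Ck k U (fun x => \sum_i f i x).
Proof.
move=> oU; elim: n f => [|n IH] f H.
  rewrite (_ : (fun x => _) = (fun=> 0)); first exact: Ck_cst.
  by apply/funext => x; rewrite big_ord0.
rewrite (_ : (fun x => _) = (fun x => f ord0 x + \sum_i f (lift ord0 i) x)).
  by apply: CkD => //; exact: IH.
by apply/funext => x; rewrite big_ord_recl.
Qed.

Lemma Ck_coord V k n (U : set V) (f : V -> 'rV[R]_n) i : open U ->
  Ck k U f -> Ck k U (fun x => f x 0 i).
Proof.
move=> oU; elim: k f => [|k IH] f [cf Hf].
  split=> // x Ux.
  apply: (@continuous_comp _ _ _ f (fun y : 'rV[R]_n => y 0 i)).
    exact: cf.
  exact: coord_continuous.
split=> [x Ux|v].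
  apply: (@continuous_comp _ _ _ f (fun y : 'rV[R]_n => y 0 i)).
    exact: cf.
  exact: coord_continuous.
have [df Df] := Hf v; split=> [x Ux|].
  by have /derivable_mxP := df x Ux; exact.
apply: Ck_eq (IH _ Df) => // x Ux.
by rewrite derive_coord //; exact: df.
Qed.

Lemma Ck_rV V k n (U : set V) (f : V -> 'rV[R]_n) : open U ->
  (forall i, Ck k U (fun x => f x 0 i)) -> Ck k U f.
Proof.
move=> oU; elim: k f => [|k IH] f H.
  split=> // x Ux; apply: cvg_rV => i.
  by have [cf _] := H i; exact: cf.
split=> [x Ux|v].
  by apply: cvg_rV => i; have [cf _] := H i; exact: cf.
have df x : U x -> derivable f x v.
  move=> Ux; apply/derivable_mxP => i j; rewrite ord1.
  by have [_ /(_ v)[dfj _]] := H j; exact: dfj.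
split=> //; apply: IH => i; have [_ /(_ v)[dfi Dfi]] := H i.
by apply: Ck_eq Dfi => // x Ux; rewrite derive_coord //; exact: df.
Qed.

Lemma C1_differentiable n (U : set 'rV[R]_n) (f : 'rV[R]_n -> R) x :
  open U -> U x -> Ck 1 U f -> differentiable f x.
Proof.
move=> oU Ux [_ H]; apply: differentiable_of_continuous_partials.
  apply: filterS (open_nbhs_nbhs (conj oU Ux)) => y Uy i.
  by have [df _] := H (delta_mx 0 i); exact: df.
by move=> i; have [_ [cf _]] := H (delta_mx 0 i); exact: cf.
Qed.

Lemma C1_differentiable_rV n m (U : set 'rV[R]_n) (f : 'rV[R]_n -> 'rV[R]_m) x :
  open U -> U x -> Ck 1 U f -> differentiable f x.
Proof.
move=> oU Ux Cf; apply: differentiable_rV => i.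
by apply: (C1_differentiable oU Ux); exact: Ck_coord.
Qed.

(** By induction on [k]: a directional derivative of [g \o f] is a sum of
    products of components of a derivative of [f] with partial derivatives of
    [g] composed with [f]. *)
Lemma Ck_comp V m k (U : set V) (O : set 'rV[R]_m) (f : V -> 'rV[R]_m)
    (g : 'rV[R]_m -> R) : open U -> open O -> (forall x, U x -> O (f x)) ->
  Ck k U f -> Ck k O g -> Ck k U (g \o f).
Proof.
move=> oU oO UO; elim: k f g UO => [|k IH] f g UO Cf Cg.
  have [cf _] := Cf; have [cg _] := Cg.
  split=> // x Ux; apply: continuous_comp; first exact: cf.
  by apply: cg; exact: UO.
have [cf Hf] := Cf; have [cg Hg] := Cg.
split=> [x Ux|v].
  apply: continuous_comp; first exact: cf.
  by apply: cg; exact: UO.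
have [df Df] := Hf v.
have dg x : U x -> differentiable g (f x).
  move=> /UO Ox; apply: (C1_differentiable oO Ox).
  by elim: (k) Cg => // j IHj /Ck_S.
have D x (Ux : U x) := is_derive_comp (df x Ux) (dg x Ux).
split=> [x /D[]//|].
apply: (@Ck_eq _ _ _ _
  (fun x => \sum_i 'D_v f x 0 i * 'D_(delta_mx 0 i) g (f x))) => //.
  move=> x Ux; have [_ ->] := D x Ux.
  by rewrite derive_sum_delta //; exact: dg.
apply: Ck_sum => // i; apply: CkM => //; first exact: Ck_coord.
have [_ Dg] := Hg (delta_mx 0 i).
by apply: (IH f (fun y => 'D_(delta_mx 0 i) g y)) => //; exact: Ck_S.
Qed.

End Ck.

(** * Symmetry of mixed derivatives *)

Section Schwarz.
Context {R : realType}.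
Implicit Types V W : normedModType R.

Lemma is_derive_translate V W (f : V -> W) (c x v : V) :
  derivable f (c + x) v ->
  is_derive x v (fun y => f (c + y)) ('D_v f (c + x)).
Proof.
have E : (fun h : R => h^-1 *: (((fun y => f (c + y)) \o shift x) (h *: v)
     - f (c + x))) =
  (fun h : R => h^-1 *: ((f \o shift (c + x)) (h *: v) - f (c + x))).
  by apply/funext => h /=; rewrite addrCA.
by move=> df; split; rewrite /derivable /derive E.
Qed.

(** The mean value theorem in the direction [u], for the difference of two
    translates of [f], and then in the direction [v].  The second difference on
    the left is symmetric in [u] and [v]. *)
Lemma second_difference V (f : V -> R) (x u v : V) (d s : R) : 0 <= s ->
  (forall y, `|y - x| < d -> derivable f y u) ->
  (forall y, `|y - x| < d -> derivable (fun z => 'D_u f z) y v) ->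
  s * (`|u| + `|v|) < d ->
  exists2 y, `|y - x| < d &
    f (s *: v + (s *: u + x)) - f (s *: u + x) - (f (s *: v + x) - f x) =
    s * (s * 'D_v (fun z => 'D_u f z) y).
Proof.
move=> s0 df ddf sd.
have near_x p q : p \in `[0, 1] -> q \in `[0, 1] ->
    `|p *: (s *: v) + (q *: (s *: u) + x) - x| < d.
  rewrite !in_itv /= => /andP[p0 p1] /andP[q0 q1]; apply: le_lt_trans sd.
  rewrite addrA addrK (le_trans (ler_normD _ _)) // !normrZ !ger0_norm //.
  rewrite addrC mulrDr; apply: lerD; rewrite ler_piMl // mulr_ge0 //.
have I0 : (0 : R) \in `[0, 1] by rewrite in_itv /= lexx ler01.
have I1 : (1 : R) \in `[0, 1] by rewrite in_itv /= lexx ler01.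
pose g z := f (s *: v + z) - f z.
have dg q : q \in `[0, 1] -> is_derive (q *: (s *: u) + x) (s *: u) g
    (s *: ('D_u f (s *: v + (q *: (s *: u) + x)) - 'D_u f (q *: (s *: u) + x))).
  move=> Iq.
  have H1 : derivable f (s *: v + (q *: (s *: u) + x)) u.
    by apply: df; have := near_x 1 q I1 Iq; rewrite scale1r.
  have H0 : derivable f (q *: (s *: u) + x) u.
    by apply: df; have := near_x 0 q I0 Iq; rewrite scale0r add0r.
  have [T1 T2] := is_derive_translate H1.
  have dgu : derivable g (q *: (s *: u) + x) u by exact: derivableB.
  have [D1 D2] := derivable_scale s dgu.
  split=> //; rewrite D2; congr (_ *: _).
  rewrite -T2; exact: (@deriveB R V R (fun y => f (s *: v + y)) f _ u T1 H0).
have [|q Iq Eq] := @directional_MVT R V g x (s *: u).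
  by move=> q /dg[].
have Iq' : q \in `[0, 1].
  by move: Iq; rewrite !in_itv /= => /andP[/ltW -> /ltW ->].
have ddu p : p \in `[0, 1] -> is_derive (p *: (s *: v) + (q *: (s *: u) + x))
    (s *: v) (fun z => 'D_u f z)
    (s *: 'D_v (fun z => 'D_u f z) (p *: (s *: v) + (q *: (s *: u) + x))).
  by move=> Ip; apply: derivable_scale; apply: ddf; exact: near_x.
have [|p Ip Ep] := @directional_MVT R V (fun z => 'D_u f z)
    (q *: (s *: u) + x) (s *: v).
  by move=> p /ddu[].
have Ip' : p \in `[0, 1].
  by move: Ip; rewrite !in_itv /= => /andP[/ltW -> /ltW ->].
exists (p *: (s *: v) + (q *: (s *: u) + x)); first exact: near_x.
have [_ D] := dg q Iq'; move: Eq; rewrite D Ep; have [_ ->] := ddu p Ip'.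
by rewrite /g => ->.
Qed.

Lemma dist_halves (a b c e : R) :
  `|a - c| <= e / 2 -> `|b - c| <= e / 2 -> `|a - b| <= e.
Proof.
move=> ac bc; rewrite -(subrKA c) [leRHS]splitr.
by rewrite (le_trans (ler_normD _ _)) // lerD // distrC.
Qed.

(** Both mixed derivatives, taken at points close to [x], equal the same second
    difference divided by the square of [s]. *)
Lemma schwarz V (f : V -> R) (U : set V) (x u v : V) : open U -> U x ->
  Ck 2 U f ->
  'D_v (fun y => 'D_u f y) x = 'D_u (fun y => 'D_v f y) x.
Proof.
move=> oU Ux [_ H].
have [du [_ Hu]] := H u; have [dv [_ Hv]] := H v.
have [duv [cuv _]] := Hu v; have [dvu [cvu _]] := Hv u.
set a := LHS; set b := RHS.
apply/eqP; rewrite -subr_eq0 -normr_le0; apply/ler_addgt0Pl => e e0.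
rewrite addr0.
have e20 : 0 < e / 2 by rewrite divr_gt0.
have : \forall y \near x, U y /\
   (`|a - 'D_v (fun y => 'D_u f y) y| <= e / 2 /\
    `|b - 'D_u (fun y => 'D_v f y) y| <= e / 2).
  apply: filterI; first exact: open_nbhs_nbhs.
  apply: filterI.
    by have /cvgrPdist_le /(_ _ e20) := cuv x Ux.
  by have /cvgrPdist_le /(_ _ e20) := cvu x Ux.
move=> /nbhs_normP[d /= d0 K].
have {}K y : `|y - x| < d -> U y /\
   (`|a - 'D_v (fun y => 'D_u f y) y| <= e / 2 /\
    `|b - 'D_u (fun y => 'D_v f y) y| <= e / 2).
  by move=> yx; apply: K; rewrite /ball_ /= distrC.
(* The parallelogram spanned by [s *: u] and [s *: v] stays within distance
   [d]; the summand 1 covers [u = v = 0]. *)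
pose s := d / (`|u| + `|v| + 1).
have N0 : 0 < `|u| + `|v| + 1 by rewrite ltr_wpDl // addr_ge0.
have s0 : 0 < s by rewrite divr_gt0.
have sd : s * (`|u| + `|v|) < d.
  by rewrite /s mulrAC ltr_pdivrMr // ltr_pM2l // ltrDl.
have [||y1 Y1 E1] := @second_difference _ f x u v d s (ltW s0) _ _ sd.
- by move=> y /K[Uy _]; exact: du.
- by move=> y /K[Uy _]; exact: duv.
have sd' : s * (`|v| + `|u|) < d by rewrite addrC.
have [||y2 Y2 E2] := @second_difference _ f x v u d s (ltW s0) _ _ sd'.
- by move=> y /K[Uy _]; exact: dv.
- by move=> y /K[Uy _]; exact: dvu.
have [_ [A1 _]] := K y1 Y1; have [_ [_ A2]] := K y2 Y2.
move: A1 A2 E1 E2; move: ('D_v _ y1) ('D_u _ y2) => c1 c2.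
clearbody a b => A1 A2 E1 E2; apply: (dist_halves A1).
suff -> : c1 = c2 by [].
have sn0 : s != 0 by rewrite gt_eqF.
apply: (mulfI sn0); apply: (mulfI sn0); rewrite -E1 -E2 (addrCA (s *: u)).
by rewrite -!addrA !opprD !opprK; congr (_ + _); rewrite addrCA.
Qed.

End Schwarz.

(** * Maps smooth near a point *)

(** One neighbourhood serves all orders of differentiability. *)
Definition smooth_at (R : realType) (V W : normedModType R) (f : V -> W)
    (x : V) : Prop :=
  exists U : set V, [/\ open U, U x & smooth_on U f].

Section SmoothAt.
Context {R : realType}.
Implicit Types V W : normedModType R.

Lemma near_open (T : topologicalType) (x : T) (P : T -> Prop) :
  (\forall y \near x, P y) ->
  exists B, [/\ open B, B x & forall y, B y -> P y].
Proof.
move=> H; have : nbhs x [set y | P y] := H.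
by rewrite nbhsE => -[B [oB Bx] BP]; exists B.
Qed.

Lemma smooth_on_at V W (U : set V) (f : V -> W) x :
  nbhs x U -> smooth_on U f -> smooth_at f x.
Proof.
move=> nU sf; exists (interior U); split; [exact: open_interior | exact: nU |].
by move=> k; apply: Ck_sub (sf k); exact: interior_subset.
Qed.

Lemma smooth_at_on V W (U : set V) (f : V -> W) :
  (forall x, U x -> smooth_at f x) -> smooth_on U f.
Proof.
by move=> H k; apply: Ck_local => x /H[B [oB Bx sB]]; exists B.
Qed.

Lemma smooth_at_near V W (f : V -> W) x :
  smooth_at f x -> \forall y \near x, smooth_at f y.
Proof.
move=> [U [oU Ux sU]]; apply: filterS (open_nbhs_nbhs (conj oU Ux)) => y Uy.
by exists U.
Qed.

Lemma smooth_at_eq V W (f g : V -> W) x :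
  (\forall y \near x, f y = g y) -> smooth_at f x -> smooth_at g x.
Proof.
move=> fg [U [oU Ux sU]].
have : \forall y \near x, U y /\ f y = g y.
  by apply: filterI => //; exact: open_nbhs_nbhs.
move=> /near_open[B [oB Bx BU]].
exists B; split=> // k; apply: (@Ck_eq _ _ _ _ _ f) => //.
  by move=> y /BU[].
by apply: Ck_sub (sU k) => y /BU[].
Qed.

Lemma smooth_at_continuous V W (f : V -> W) x :
  smooth_at f x -> {for x, continuous f}.
Proof. by move=> [U [_ Ux /(_ 0)[cf _]]]; exact: cf. Qed.

Lemma smooth_at_derivable V W (f : V -> W) x v :
  smooth_at f x -> derivable f x v.
Proof. by move=> [U [_ Ux /(_ 1)[_ /(_ v)[df _]]]]; exact: df. Qed.

Lemma smooth_at_differentiable n (f : 'rV[R]_n -> R) x :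
  smooth_at f x -> differentiable f x.
Proof. by move=> [U [oU Ux sU]]; apply: (C1_differentiable oU Ux). Qed.

Lemma smooth_at_differentiable_rV n m (f : 'rV[R]_n -> 'rV[R]_m) x :
  smooth_at f x -> differentiable f x.
Proof. by move=> [U [oU Ux sU]]; apply: (C1_differentiable_rV oU Ux). Qed.

Lemma smooth_at_derive V W (f : V -> W) x v :
  smooth_at f x -> smooth_at (fun y => 'D_v f y) x.
Proof.
move=> [U [oU Ux sU]]; exists U; split=> // k.
by have [_ /(_ v)[]] := sU k.+1.
Qed.

Lemma smooth_at_cst V W (w : W) (x : V) : smooth_at (fun _ => w) x.
Proof. by exists setT; split=> //; [exact: openT | move=> k; exact: Ck_cst]. Qed.

Lemma smooth_atD V W (f g : V -> W) x :
  smooth_at f x -> smooth_at g x -> smooth_at (fun y => f y + g y) x.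
Proof.
move=> [U [oU Ux sU]] [U' [oU' U'x sU']]; have oI := openI oU oU'.
exists (U `&` U'); split=> // k; apply: CkD => //.
  by apply: Ck_sub (sU k); exact: subIsetl.
by apply: Ck_sub (sU' k); exact: subIsetr.
Qed.

Lemma smooth_atM V (f g : V -> R) x :
  smooth_at f x -> smooth_at g x -> smooth_at (fun y => f y * g y) x.
Proof.
move=> [U [oU Ux sU]] [U' [oU' U'x sU']]; have oI := openI oU oU'.
exists (U `&` U'); split=> // k; apply: CkM => //.
  by apply: Ck_sub (sU k); exact: subIsetl.
by apply: Ck_sub (sU' k); exact: subIsetr.
Qed.

Lemma smooth_atB V (f g : V -> R) x :
  smooth_at f x -> smooth_at g x -> smooth_at (fun y => f y - g y) x.
Proof.
move=> sf sg.
apply: (smooth_at_eq _ (smooth_atD sf (smooth_atM (smooth_at_cst (-1 : R) x) sg))).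
by near=> y; rewrite mulN1r.
Unshelve. all: by end_near. Qed.

Lemma smooth_at_sum V W n (f : 'I_n -> V -> W) x :
  (forall i, smooth_at (f i) x) -> smooth_at (fun y => \sum_i f i y) x.
Proof.
elim: n f => [|n IH] f H.
  rewrite (_ : (fun x => _) = (fun=> 0)); first exact: smooth_at_cst.
  by apply/funext => y; rewrite big_ord0.
rewrite (_ : (fun x => _) = (fun x => f ord0 x + \sum_i f (lift ord0 i) x)).
  by apply: smooth_atD => //; exact: IH.
by apply/funext => y; rewrite big_ord_recl.
Qed.

Lemma smooth_at_coord V n (f : V -> 'rV[R]_n) i x :
  smooth_at f x -> smooth_at (fun y => f y 0 i) x.
Proof.
by move=> [U [oU Ux sU]]; exists U; split=> // k; exact: Ck_coord.
Qed.

Lemma smooth_at_rV V n (f : V -> 'rV[R]_n) x :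
  (forall i, smooth_at (fun y => f y 0 i) x) -> smooth_at f x.
Proof.
move=> H; suff [U [oU Ux sU]] : exists U : set V,
    [/\ open U, U x & forall i, smooth_on U (fun y => f y 0 i)].
  by exists U; split=> // k; apply: Ck_rV => // i; exact: sU.
have : \forall y \near x, forall i, smooth_at (fun z => f z 0 i) y.
  apply: (@filter_forall _ _ (fun i y => smooth_at (fun z => f z 0 i) y)
    (nbhs x)) => i.
  exact: smooth_at_near.
move=> /near_open[B [oB Bx BU]].
by exists B; split=> // i; apply: smooth_at_on => y /BU; exact.
Qed.

Lemma smooth_at_comp V m (f : V -> 'rV[R]_m) (g : 'rV[R]_m -> R) x :
  smooth_at f x -> smooth_at g (f x) -> smooth_at (g \o f) x.
Proof.
move=> sf [B [oB Bfx sB]].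
have : \forall y \near x, smooth_at f y /\ B (f y).
  apply: filterI; first exact: smooth_at_near.
  by apply: (smooth_at_continuous sf); exact: open_nbhs_nbhs.
move=> /near_open[U [oU Ux UB]].
exists U; split=> // k; apply: (@Ck_comp _ _ _ _ U B) => //.
  by move=> y /UB[].
by apply: smooth_at_on => y /UB[].
Qed.

Lemma smooth_at_comp_rV V m n (f : V -> 'rV[R]_m) (g : 'rV[R]_m -> 'rV[R]_n) x :
  smooth_at f x -> smooth_at g (f x) -> smooth_at (g \o f) x.
Proof.
move=> sf sg; apply: smooth_at_rV => i.
exact: (@smooth_at_comp _ _ f (fun y => g y 0 i) x sf (smooth_at_coord i sg)).
Qed.

(** Derivatives along [v] become derivatives along [L v], whatever the
    dimensions, so that this also applies to maps out of product charts. *)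
Lemma Ck_affine V V' W k (L : {linear V -> V'}) (c : V') (U : set V')
    (f : V' -> W) : continuous L -> Ck k U f ->
  Ck k [set x | U (L x + c)] (fun x => f (L x + c)).
Proof.
move=> cL; elim: k f => [|k IH] f [cf Hf].
  split=> // x Ux; apply: (@continuous_comp _ _ _ (fun x => L x + c)).
    by apply: cvgD; [exact: cL | exact: cvg_cst].
  exact: cf.
split=> [x Ux|v].
  apply: (@continuous_comp _ _ _ (fun x => L x + c)).
    by apply: cvgD; [exact: cL | exact: cvg_cst].
  exact: cf.
have [df Df] := Hf (L v).
have E x : (fun h : R => h^-1 *:
      (((fun y => f (L y + c)) \o shift x) (h *: v) - f (L x + c))) =
    (fun h : R => h^-1 *:
      ((f \o shift (L x + c)) (h *: L v) - f (L x + c))).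
  apply/funext => h /=; by rewrite linearP addrA.
split=> [x Ux|]; first by rewrite /derivable E; exact: df.
rewrite (_ : (fun x => _) = (fun x => 'D_(L v) f (L x + c))).
  exact: (IH (fun y => 'D_(L v) f y)).
by apply/funext => x; rewrite /derive E.
Qed.

Lemma smooth_at_affine V V' W (L : {linear V -> V'}) (c : V') (f : V' -> W) x :
  continuous L -> smooth_at f (L x + c) ->
  smooth_at (fun y => f (L y + c)) x.
Proof.
move=> cL [U [oU Ux sU]]; exists [set y | U (L y + c)]; split=> //.
  apply: open_comp oU => y _.
  by apply: cvgD; [exact: cL | exact: cvg_cst].
by move=> k; exact: Ck_affine.
Qed.

Lemma schwarz_at V (f : V -> R) (x u v : V) : smooth_at f x ->
  'D_v (fun y => 'D_u f y) x = 'D_u (fun y => 'D_v f y) x.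
Proof. by move=> [U [oU Ux sU]]; apply: (schwarz u v oU Ux). Qed.

Lemma schwarz_at_rV V n (f : V -> 'rV[R]_n) (x u v : V) : smooth_at f x ->
  'D_v (fun y => 'D_u f y) x = 'D_u (fun y => 'D_v f y) x.
Proof.
move=> sf; apply/rowP => i.
have D w w' : 'D_w (fun y => 'D_w' f y) x 0 i =
    'D_w (fun y => 'D_w' (fun z => f z 0 i) y) x.
  rewrite -derive_coord; last by apply/smooth_at_derivable/smooth_at_derive.
  apply: near_eq_derive; apply: filterS (smooth_at_near sf) => y sy.
  by rewrite derive_coord //; exact: smooth_at_derivable.
exact: (etrans (D v u) (etrans (schwarz_at u v (smooth_at_coord i sf))
  (esym (D u v)))).
Qed.

Lemma derive_comp_smooth V m W (f : V -> 'rV[R]_m) (g : 'rV[R]_m -> W) x v :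
  smooth_at f x -> differentiable g (f x) ->
  'D_v (g \o f) x = 'D_('D_v f x) g (f x).
Proof.
move=> sf dg; have df : derivable f x v := smooth_at_derivable sf.
by have [_ ->] := is_derive_comp df dg.
Qed.

Lemma derive_linear n W (f : 'rV[R]_n -> W) x : differentiable f x ->
  linear (fun v => 'D_v f x).
Proof. by move=> df a u v; rewrite !deriveE // linearP. Qed.

End SmoothAt.

Local Opaque derive.

(** * The exterior derivative in coordinates *)

Section CoordinateForms.
Context {R : realType}.
Implicit Types V W : normedModType R.

Lemma scalar_sum_delta m (phi : 'rV[R]_m -> R) (w : 'rV[R]_m) : scalar phi ->
  phi w = \sum_i w 0 i * phi (delta_mx 0 i).
Proof.
move=> lphi; pose L := GRing.isLinear.Build R _ _ _ phi lphi.
pose phi' : {linear 'rV[R]_m -> R} := HB.pack phi L.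
rewrite {1}[w]row_sum_delta -[phi]/(phi' : _ -> _) linear_sum.
by apply: eq_bigr => i _; rewrite linearZ.
Qed.

(** Product rule for the pairing of a covector field with a vector field:
    [a w y] is the value on [w] of the covector at [y]. *)
Lemma is_derive_contract V m (a : 'rV[R]_m -> V -> R) (h : V -> 'rV[R]_m) x u :
  (forall w, derivable (a w) x u) -> derivable h x u ->
  (\forall y \near x, scalar (a^~ y)) ->
  is_derive x u (fun y => a (h y) y) (a ('D_u h x) x + 'D_u (a (h x)) x).
Proof.
move=> da dh la.
have dhi i : derivable (fun y => h y 0 i) x u by have /derivable_mxP := dh; exact.
have lax : scalar (a^~ x) := nbhs_singleton la.
have sumD (F : 'I_m -> V -> R) (d : 'I_m -> R) :
    (forall i, is_derive x u (F i) (d i)) ->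
    is_derive x u (fun y => \sum_i F i y) (\sum_i d i).
  move=> DF; rewrite (_ : (fun y => _) = \sum_i F i); last first.
    by apply/funext => y; rewrite fct_sumE.
  exact: (@is_derive_sum _ _ _ _ F x u d DF).
have Dm i : is_derive x u (fun y => h y 0 i * a (delta_mx 0 i) y)
    ('D_u h x 0 i * a (delta_mx 0 i) x + h x 0 i * 'D_u (a (delta_mx 0 i)) x).
  have := is_deriveM (derivableP (dhi i)) (derivableP (da (delta_mx 0 i))).
  move=> D.
  apply: (is_derive_eq D); rewrite addrC (derive_coord i dh).
  by rewrite -[X in X + _]/(_ * _) -[X in _ + X]/(_ * _) mulrC.
have Dc i : is_derive x u (fun y => h x 0 i * a (delta_mx 0 i) y)
    (h x 0 i * 'D_u (a (delta_mx 0 i)) x).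
  exact: (is_deriveZ (h x 0 i) (derivableP (da (delta_mx 0 i)))).
have [_ Ec] := sumD _ _ Dc.
have -> : 'D_u (a (h x)) x = \sum_i h x 0 i * 'D_u (a (delta_mx 0 i)) x.
  rewrite -Ec; apply: near_eq_derive.
  by apply: filterS la => y ly; rewrite [LHS](scalar_sum_delta _ ly).
rewrite (scalar_sum_delta ('D_u h x) lax) -big_split /=.
apply: near_eq_is_derive (sumD _ _ Dm).
by apply: filterS la => y ly; rewrite [RHS](scalar_sum_delta _ ly).
Qed.

Lemma smooth_at_contract V m (a : 'rV[R]_m -> V -> R) (h : V -> 'rV[R]_m) x :
  (forall w, smooth_at (a w) x) -> smooth_at h x ->
  (\forall y \near x, scalar (a^~ y)) -> smooth_at (fun y => a (h y) y) x.
Proof.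
move=> sa sh la.
apply: (@smooth_at_eq _ _ _ (fun y => \sum_i h y 0 i * a (delta_mx 0 i) y)).
  by apply: filterS la => y ly; rewrite [RHS](scalar_sum_delta _ ly).
by apply: smooth_at_sum => i; apply: smooth_atM => //; exact: smooth_at_coord.
Qed.

(** The exterior derivative commutes with pullback: the product rule brings in
    second derivatives of [s], and they cancel because they are symmetric. *)
Lemma coord_d_pullback n m (a : 'rV[R]_m -> 'rV[R]_m -> R)
    (s : 'rV[R]_n -> 'rV[R]_m) (b : 'rV[R]_n -> 'rV[R]_n -> R) x u v :
  smooth_at s x -> (forall w, smooth_at (a w) (s x)) ->
  (\forall y \near s x, scalar (a^~ y)) ->
  (forall w, \forall y \near x, b w y = a ('D_w s y) (s y)) ->
  'D_u (b v) x - 'D_v (b u) x =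
  'D_('D_u s x) (a ('D_v s x)) (s x) - 'D_('D_v s x) (a ('D_u s x)) (s x).
Proof.
move=> ss sa la bE.
have cs := smooth_at_continuous ss.
have las : \forall y \near x, scalar (a^~ (s y)).
  by have := cs _ la.
have half u' v' : 'D_u' (b v') x =
    a ('D_u' (fun y => 'D_v' s y) x) (s x) + 'D_('D_u' s x) (a ('D_v' s x)) (s x).
  rewrite (near_eq_derive _ (bE v')).
  have da w : is_derive x u' (a w \o s) ('D_('D_u' s x) (a w) (s x)).
    apply: is_derive_comp; first exact: smooth_at_derivable.
    exact: smooth_at_differentiable.
  have dh : derivable (fun y => 'D_v' s y) x u'.
    exact: (smooth_at_derivable (smooth_at_derive v' ss)).
  have [|_ ->] := @is_derive_contract _ _ (fun w y => a w (s y))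
      (fun y => 'D_v' s y) x u' _ dh las.
    by move=> w; have [] := da w.
  by congr (_ + _); have [_] := da ('D_v' s x).
rewrite (half u v) (half v u) (schwarz_at_rV u v ss) opprD addrACA.
by rewrite subrr add0r.
Qed.

End CoordinateForms.

Local Notation coord := Defs.coord.

(** * Charts and tangent maps *)

Section Charts.
Context {R : realType}.

Section OneManifold.
Context {n : nat} (M : manifold R n).
Implicit Types p q : M.

Lemma mimg_mloc p q : mdom p q -> mimg p (mloc p q).
Proof. by exists q. Qed.

Lemma mimg_center p : mimg p (mloc p p).
Proof. exact/mimg_mloc/mdom_center. Qed.

Lemma mimgP p x : mimg p x -> mdom p (minv p x) /\ mloc p (minv p x) = x.
Proof. by move=> [q pq <-]; rewrite mlocK. Qed.

Lemma near_chart p q (P : M -> Prop) : mdom p q ->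
  (\forall q' \near q, P q') ->
  \forall y \near mloc p q,
    [/\ mdom p (minv p y), mloc p (minv p y) = y & P (minv p y)].
Proof.
move=> pq nP.
have n1 : \forall y \near mloc p q, mimg p y.
  by apply: open_nbhs_nbhs; split; [exact: mimg_open | exact: mimg_mloc].
have n2 : \forall y \near mloc p q, P (minv p y).
  have cv : {for mloc p q, continuous (minv p)} := minv_continuous (mimg_mloc pq).
  by apply: cv; rewrite mlocK.
apply: filterS2 n1 n2 => y /mimgP[py py'] Py; split=> //.
Qed.

Lemma near_mdom p q : mdom p q -> \forall q' \near q, mdom p q'.
Proof. by move=> pq; apply: open_nbhs_nbhs; split=> //; exact: mdom_open. Qed.

End OneManifold.

(** All charts around [p] and [f p] are allowed, not only the centred ones, so
    that compositions need no change of chart. *)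
Definition smooth_map_at n m (M : manifold R n) (N : manifold R m)
    (f : M -> N) (p : M) : Prop :=
  {for p, continuous f} /\
  forall a b, mdom a p -> mdom b (f p) ->
    smooth_at (mloc b \o f \o minv a) (mloc a p).

(** The tangent map of [f] at [p] in the charts at [a] and [b]; [tmap], [frame]
    and [coord] are the cases where charts are centred or [f] is the
    identity. *)
Definition drep n m (M : manifold R n) (N : manifold R m) (a : M) (b : N)
    (f : M -> N) (p : M) (u : 'rV[R]_n) : 'rV[R]_m :=
  'D_u (mloc b \o f \o minv a) (mloc a p).

Lemma smooth_map_on_at n m (M : manifold R n) (N : manifold R m) (O : set M)
    (f : M -> N) p :
  open O -> O p -> smooth_map_on O f -> smooth_map_at f p.
Proof.
move=> oO Op [cf sf]; split=> [|a b ap bp]; first exact: cf.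
apply: smooth_on_at (sf a b).
have nb : \forall q \near p, O q /\ mdom b (f q).
  apply: filterI; first exact: open_nbhs_nbhs.
  by apply: (cf p Op); exact: near_mdom.
apply: filterS (near_chart ap nb) => y [ay ayy [Oy by']].
by split=> //; rewrite -ayy; exact: mimg_mloc.
Qed.

Lemma smooth_map_at_global n m (M : manifold R n) (N : manifold R m)
    (f : M -> N) p : smooth_map f -> smooth_map_at f p.
Proof. by move=> sf; apply: smooth_map_on_at sf => //; exact: openT. Qed.

Lemma smooth_map_at_id n (M : manifold R n) (p : M) : smooth_map_at id p.
Proof.
split=> [|a b ap bp]; first by move=> ? ?.
apply: smooth_on_at (@mtransition_smooth _ _ M a b).
apply: filterS (near_chart ap (near_mdom bp)) => y [ay ayy by'].
by split=> //; rewrite -ayy; exact: mimg_mloc.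
Qed.

Lemma drep_near n m (M : manifold R n) (N : manifold R m) (a : M) (b : N)
    (f g : M -> N) p u : mdom a p -> (\forall q \near p, f q = g q) ->
  drep a b f p u = drep a b g p u.
Proof.
move=> ap fg; apply: near_eq_derive.
by apply: filterS (near_chart ap fg) => y [_ _ e] /=; rewrite e.
Qed.

Section Composition.
Context {n m l : nat} {M : manifold R n} {N : manifold R m} {Q : manifold R l}.
Variables (f : M -> N) (g : N -> Q) (p : M).
Hypotheses (sf : smooth_map_at f p) (sg : smooth_map_at g (f p)).

Lemma chart_comp_near a b c : mdom a p -> mdom b (f p) ->
  \forall y \near mloc a p,
    ((mloc c \o g \o minv b) \o (mloc b \o f \o minv a)) y =
    (mloc c \o (g \o f) \o minv a) y.
Proof.
move=> ap bp.
have nb : \forall q \near p, mdom b (f q) by apply: sf.1; exact: near_mdom.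
by apply: filterS (near_chart ap nb) => y [_ _ by'] /=; rewrite mlocK.
Qed.

(** Near the point the coordinate maps compose because the middle chart
    cancels. *)
Lemma drep_comp a b c u : mdom a p -> mdom b (f p) -> mdom c (g (f p)) ->
  drep a c (g \o f) p u = drep b c g (f p) (drep a b f p u).
Proof.
move=> ap bp cp; have ss := sf.2 a b ap bp; have st := sg.2 b c bp cp.
transitivity ('D_u ((mloc c \o g \o minv b) \o (mloc b \o f \o minv a)) (mloc a p)).
  by apply: near_eq_derive; apply: filterS (chart_comp_near c ap bp) => y ->.
rewrite derive_comp_smooth //=; first by rewrite /drep mlocK.
by rewrite mlocK //; exact: smooth_at_differentiable_rV.
Qed.

End Composition.

Lemma drep_id n (M : manifold R n) (a p : M) u : mdom a p ->
  drep a a id p u = u.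
Proof.
move=> ap; transitivity ('D_u (id : 'rV[R]_n -> 'rV[R]_n) (mloc a p)).
  apply: near_eq_derive.
  by apply: filterS (near_chart ap (near_mdom ap)) => y [_ e _] /=; rewrite e.
exact: derive_id.
Qed.

Lemma drep_linear n m (M : manifold R n) (N : manifold R m) (f : M -> N) a b p :
  smooth_map_at f p -> mdom a p -> mdom b (f p) -> linear (drep a b f p).
Proof.
move=> sf ap bp; apply: derive_linear; apply: smooth_at_differentiable_rV.
exact: sf.2.
Qed.

Lemma tmapE n m (M : manifold R n) (N : manifold R m) (f : M -> N) p v :
  tmap f p v = drep p (f p) f p v.
Proof. by []. Qed.

Lemma frameE n (M : manifold R n) (a p : M) u : mdom a p ->
  frame a (mloc a p) u = drep a p id p u.
Proof. by move=> ap; rewrite /frame mlocK. Qed.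

Lemma coordE n (M : manifold R n) (a p : M) w : coord a p w = drep p a id p w.
Proof. by []. Qed.

Lemma frameK n (M : manifold R n) (a p : M) w : mdom a p ->
  frame a (mloc a p) (coord a p w) = w.
Proof.
move=> ap; have pp := mdom_center p; have sid := smooth_map_at_id.
rewrite frameE // coordE -(drep_comp (sid _ _ p) (sid _ _ p)) //.
exact: drep_id.
Qed.

Lemma frame_linear n (M : manifold R n) (a p : M) : mdom a p ->
  linear (frame a (mloc a p)).
Proof.
move=> ap c u v; rewrite !frameE //.
by apply: drep_linear => //; [exact: smooth_map_at_id | exact: mdom_center].
Qed.

Lemma frame_center n (M : manifold R n) (p : M) u : frame p (mloc p p) u = u.
Proof. by rewrite frameE ?drep_id //; exact: mdom_center. Qed.

Lemma coord_center n (M : manifold R n) (p : M) u : coord p p u = u.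
Proof. by rewrite coordE drep_id //; exact: mdom_center. Qed.

Lemma drep_coord n m (M : manifold R n) (N : manifold R m) (f : M -> N) a b p u :
  smooth_map_at f p -> mdom a p -> mdom b (f p) ->
  drep a b f p u = coord b (f p) (tmap f p (frame a (mloc a p) u)).
Proof.
move=> sf ap bp; have pp := mdom_center p; have fpp := mdom_center (f p).
rewrite frameE // coordE tmapE.
have E1 := drep_comp sf (smooth_map_at_id (f p)) u ap fpp bp.
have E2 := drep_comp (smooth_map_at_id p) sf u ap pp fpp.
exact: (etrans E1 (congr1 (drep (f p) b id (f p)) E2)).
Qed.

Lemma tmap_frame n m (M : manifold R n) (N : manifold R m) (f : M -> N) a b p u :
  smooth_map_at f p -> mdom a p -> mdom b (f p) ->
  tmap f p (frame a (mloc a p) u) = frame b (mloc b (f p)) (drep a b f p u).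
Proof. by move=> sf ap bp; rewrite (drep_coord u sf ap bp) frameK. Qed.

Lemma tmap_comp n m l (M : manifold R n) (N : manifold R m) (Q : manifold R l)
    (f : M -> N) (g : N -> Q) p v :
  smooth_map_at f p -> smooth_map_at g (f p) ->
  tmap (g \o f) p v = tmap g (f p) (tmap f p v).
Proof.
by move=> sf sg; apply: drep_comp => //; exact: mdom_center.
Qed.

Lemma tmap_id n (M : manifold R n) (p : M) v : tmap id p v = v.
Proof. by apply: drep_id; exact: mdom_center. Qed.

Lemma tmap_near n m (M : manifold R n) (N : manifold R m) (f g : M -> N) p v :
  (\forall q \near p, f q = g q) -> tmap f p v = tmap g p v.
Proof.
move=> fg; rewrite !tmapE (nbhs_singleton fg).
by apply: drep_near fg; exact: mdom_center.
Qed.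

Lemma tmap_linear n m (M : manifold R n) (N : manifold R m) (f : M -> N) p :
  smooth_map_at f p -> linear (tmap f p).
Proof. by move=> sf; apply: drep_linear => //; exact: mdom_center. Qed.

Lemma tmap_cst n m (M : manifold R n) (N : manifold R m) (c : N) (p : M) v :
  tmap (fun _ => c) p v = 0.
Proof.
rewrite /tmap (_ : _ \o _ = (fun=> mloc c c)) //; exact: derive_cst.
Qed.

End Charts.

(** * Differential forms on manifolds *)

Section Forms.
Context {R : realType}.

Lemma near_all (T : topologicalType) (x : T) (P : T -> Prop) :
  (forall y, P y) -> \forall y \near x, P y.
Proof. by move=> H; exact: filterS filterT. Qed.

Lemma rep1E n (M : manifold R n) (a : form1 M) (p q : M) u : mdom p q ->
  rep1 a p u (mloc p q) = a q (frame p (mloc p q) u).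
Proof. by move=> pq; rewrite /rep1 mlocK. Qed.

Lemma rep1_center n (M : manifold R n) (a : form1 M) (p : M) u :
  rep1 a p u (mloc p p) = a p u.
Proof. by rewrite rep1E ?frame_center //; exact: mdom_center. Qed.

Lemma rep1_scalar n (M : manifold R n) (a : form1 M) (p q : M) :
  (forall p, scalar (a p)) -> mdom p q ->
  scalar (fun u => rep1 a p u (mloc p q)).
Proof. by move=> la pq c u v; rewrite !rep1E // frame_linear // la. Qed.

Lemma rep1_scalar_near n (M : manifold R n) (a : form1 M) (p q : M) :
  (forall p, scalar (a p)) -> mdom p q ->
  \forall y \near mloc p q, scalar (fun u => rep1 a p u y).
Proof.
move=> la pq; apply: filterS (near_chart pq (near_mdom pq)) => y [py <- _].
exact: rep1_scalar.
Qed.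

Lemma form1_smooth_at n (M : manifold R n) (a : form1 M) (p q : M) u :
  is_form1 a -> mdom p q -> smooth_at (rep1 a p u) (mloc p q).
Proof.
move=> [_ sa] pq; apply: smooth_on_at (sa p u).
by apply: open_nbhs_nbhs; split; [exact: mimg_open | exact: mimg_mloc].
Qed.

Lemma is_form1I n (M : manifold R n) (a : form1 M) : (forall p, scalar (a p)) ->
  (forall p q u, mdom p q -> smooth_at (rep1 a p u) (mloc p q)) -> is_form1 a.
Proof.
move=> la sa; split=> // p u; apply: smooth_at_on => _ [q pq <-].
exact: sa.
Qed.

Lemma rep1_pullback1 n m (M : manifold R n) (N : manifold R m) (f : M -> N)
    (a : form1 N) p q b u :
  smooth_map_at f q -> mdom p q -> mdom b (f q) ->
  rep1 (pullback1 f a) p u (mloc p q) =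
  rep1 a b (drep p b f q u) (mloc b (f q)).
Proof.
move=> sf pq bq; rewrite (rep1E _ _ pq) (rep1E a _ bq) /pullback1.
by rewrite (tmap_frame u sf pq bq).
Qed.

Section Pullback.
Context {n m : nat} {M : manifold R n} {N : manifold R m}.
Variables (f : M -> N) (a : form1 N) (q : M).
Hypotheses (sf : \forall q' \near q, smooth_map_at f q') (fa : is_form1 a).

Lemma rep1_pullback1_near p b u : mdom p q -> mdom b (f q) ->
  \forall y \near mloc p q, rep1 (pullback1 f a) p u y =
    rep1 a b ('D_u (mloc b \o f \o minv p) y) ((mloc b \o f \o minv p) y).
Proof.
move=> pq bq.
have nb : \forall q' \near q, smooth_map_at f q' /\ mdom b (f q').
  apply: filterI => //.
  by apply: (nbhs_singleton sf).1; exact: near_mdom.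
apply: filterS (near_chart pq nb) => y [py ey [sfy by']].
by rewrite -{1}ey (rep1_pullback1 a u sfy py by') /drep ey.
Qed.

Lemma smooth_at_pullback1 p u : mdom p q ->
  smooth_at (rep1 (pullback1 f a) p u) (mloc p q).
Proof.
move=> pq; have bq := mdom_center (f q); have [cf ss] := nbhs_singleton sf.
set s := mloc (f q) \o f \o minv p.
have ssq : smooth_at s (mloc p q) by exact: ss.
have E : s (mloc p q) = mloc (f q) (f q) by rewrite /s /= mlocK.
apply: (@smooth_at_eq _ _ _ (fun y => rep1 a (f q) ('D_u s y) (s y))).
  by apply: filterS (rep1_pullback1_near u pq bq) => y ->.
apply: (@smooth_at_contract _ _ _ (fun w y => rep1 a (f q) w (s y))).
- move=> w; apply: (@smooth_at_comp _ _ _ s) => //.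
  by rewrite E; exact: form1_smooth_at.
- exact: smooth_at_derive.
- have cs := smooth_at_continuous ssq.
  have la := rep1_scalar_near fa.1 bq; rewrite -E in la.
  by have := cs _ la.
Qed.

(** Besides [dform_pullback1] this yields [dform_chart], for [f] the
    identity. *)
Lemma coord_d_pullback1 p b u v : mdom p q -> mdom b (f q) ->
  'D_u (rep1 (pullback1 f a) p v) (mloc p q)
  - 'D_v (rep1 (pullback1 f a) p u) (mloc p q) =
  'D_(drep p b f q u) (rep1 a b (drep p b f q v)) (mloc b (f q))
  - 'D_(drep p b f q v) (rep1 a b (drep p b f q u)) (mloc b (f q)).
Proof.
move=> pq bq; have [cf ss] := nbhs_singleton sf.
have E : (mloc b \o f \o minv p) (mloc p q) = mloc b (f q) by rewrite /= mlocK.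
have H := @coord_d_pullback R _ _ (rep1 a b) (mloc b \o f \o minv p)
  (rep1 (pullback1 f a) p) (mloc p q) u v (ss p b pq bq).
rewrite E in H; apply: H.
- by move=> w; exact: form1_smooth_at.
- exact: rep1_scalar_near fa.1 bq.
- by move=> w; exact: rep1_pullback1_near.
Qed.

End Pullback.

Lemma is_form1_pullback1 n m (M : manifold R n) (N : manifold R m) (f : M -> N)
    (a : form1 N) : smooth_map f -> is_form1 a -> is_form1 (pullback1 f a).
Proof.
move=> sf fa; have sfn (q : M) : \forall q' \near q, smooth_map_at f q'.
  by apply: near_all => q'; exact: smooth_map_at_global.
apply: is_form1I => [p c u v|p q u pq]; last exact: smooth_at_pullback1.
by rewrite /pullback1 tmap_linear ?fa.1 //; exact: smooth_map_at_global.
Qed.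

Lemma dform_pullback1 n m (M : manifold R n) (N : manifold R m) (f : M -> N)
    (a : form1 N) p u v : smooth_map f -> is_form1 a ->
  dform (pullback1 f a) p u v = dform a (f p) (tmap f p u) (tmap f p v).
Proof.
move=> sf fa; apply: coord_d_pullback1 => //; try exact: mdom_center.
by apply: near_all => q'; exact: smooth_map_at_global.
Qed.

(** [dform] is defined by the chart centred at the point; compatibility with
    pullback by the identity allows any other chart. *)
Lemma dform_chart n (M : manifold R n) (a : form1 M) p q u v :
  is_form1 a -> mdom p q ->
  dform a q (frame p (mloc p q) u) (frame p (mloc p q) v) =
  'D_u (rep1 a p v) (mloc p q) - 'D_v (rep1 a p u) (mloc p q).
Proof.
move=> fa pq.
have pid : pullback1 id a = a.
  by apply/funext => p'; apply/funext => w; rewrite /pullback1 tmap_id.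
have sid : \forall q' \near q, smooth_map_at (id : M -> M) q'.
  by apply: near_all => q'; exact: smooth_map_at_id.
have H := coord_d_pullback1 sid fa u v pq (mdom_center q).
rewrite pid in H; rewrite (frameE u pq) (frameE v pq); exact: esym H.
Qed.

Lemma derive_rep1_linear n (M : manifold R n) (a : form1 M) p q w :
  is_form1 a -> mdom p q ->
  scalar (fun v => 'D_w (rep1 a p v) (mloc p q)).
Proof.
move=> fa pq c u v.
have D z : derivable (rep1 a p z) (mloc p q) w.
  exact: smooth_at_derivable (form1_smooth_at z fa pq).
have [_ <-] := is_deriveD (is_deriveZ c (derivableP (D u))) (derivableP (D v)).
apply: near_eq_derive.
by apply: filterS (rep1_scalar_near fa.1 pq) => y; exact.
Qed.

Lemma sub_combination (c y y1 y2 z z1 z2 : R) :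
  y = c * y1 + y2 -> z = c * z1 + z2 -> y - z = c * (y1 - z1) + (y2 - z2).
Proof. by move=> -> ->; ring. Qed.

Lemma is_form2_dform n (M : manifold R n) (a : form1 M) :
  is_form1 a -> is_form2 (dform a).
Proof.
move=> fa; split; last by move=> p u; rewrite /dform subrr.
have pp (p : M) := mdom_center p.
have dl p w : scalar (fun u => 'D_u (rep1 a p w) (mloc p p)).
  apply: derive_linear; apply: smooth_at_differentiable.
  exact: form1_smooth_at.
split=> [p u c v w|p v c u w|p u v].
- exact: (sub_combination (derive_rep1_linear u fa (pp p) c v w) (dl p u c v w)).
- exact: (sub_combination (dl p v c u w) (derive_rep1_linear v fa (pp p) c u w)).
- apply: smooth_at_on => _ [q pq <-].
  apply: (@smooth_at_eq _ _ _
    (fun y => 'D_u (rep1 a p v) y - 'D_v (rep1 a p u) y)).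
    apply: filterS (near_chart pq (near_mdom pq)) => y [py ey _].
    by rewrite -ey /rep2 (mlocK py); exact: (esym (dform_chart u v fa py)).
  by apply: smooth_atB; apply: smooth_at_derive; exact: form1_smooth_at.
Qed.

Lemma erepE n (M : manifold R n) (A : endo M) p q u : mdom p q ->
  erep A p u (mloc p q) = coord p q (A q (frame p (mloc p q) u)).
Proof. by move=> pq; rewrite /erep mlocK. Qed.

Lemma erep_center n (M : manifold R n) (A : endo M) p u :
  erep A p u (mloc p p) = A p u.
Proof. by rewrite erepE ?coord_center ?frame_center //; exact: mdom_center. Qed.

Lemma endo_smooth_at n (M : manifold R n) (A : endo M) p q u :
  is_endo A -> mdom p q -> smooth_at (erep A p u) (mloc p q).
Proof.
move=> [_ sA] pq; apply: smooth_on_at (sA p u).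
by apply: open_nbhs_nbhs; split; [exact: mimg_open | exact: mimg_mloc].
Qed.

Lemma rep1_endo n (M : manifold R n) (A : endo M) (a : form1 M) p q u :
  mdom p q ->
  rep1 (endo_form1 A a) p u (mloc p q) =
  rep1 a p (erep A p u (mloc p q)) (mloc p q).
Proof. by move=> pq; rewrite erepE // !rep1E // frameK. Qed.

Lemma rep1_endo_near n (M : manifold R n) (A : endo M) (a : form1 M) p q u :
  mdom p q -> \forall y \near mloc p q,
    rep1 (endo_form1 A a) p u y = rep1 a p (erep A p u y) y.
Proof.
move=> pq; apply: filterS (near_chart pq (near_mdom pq)) => y [py <- _].
exact: rep1_endo.
Qed.

Lemma is_form1_endo n (M : manifold R n) (A : endo M) (a : form1 M) :
  is_endo A -> is_form1 a -> is_form1 (endo_form1 A a).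
Proof.
move=> eA fa; apply: is_form1I => [p c u v|p q u pq].
  by rewrite /endo_form1 eA.1 fa.1.
apply: (@smooth_at_eq _ _ _ (fun y => rep1 a p (erep A p u y) y)).
  by apply: filterS (rep1_endo_near A a u pq) => y ->.
apply: smooth_at_contract => [w||]; first exact: form1_smooth_at.
  exact: endo_smooth_at.
exact: rep1_scalar_near fa.1 pq.
Qed.

Lemma is_bilinear_kahler n (M : manifold R n) (g : form2 M) (A : endo M) :
  is_bilinear_field g -> is_endo A -> is_bilinear_field (kahler_form g A).
Proof.
move=> [gr gl sg] eA; split=> [p u c v w|p v c u w|p u v].
- exact: gr.
- by rewrite /kahler_form eA.1 gl.
apply: smooth_at_on => _ [q pq <-].
apply: (@smooth_at_eq _ _ _ (fun y => rep2 g p (erep A p u y) v y)).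
  apply: filterS (near_chart pq (near_mdom pq)) => y [py ey _].
  by rewrite -ey /rep2 erepE // mlocK // frameK.
apply: (@smooth_at_contract _ _ _ (fun w y => rep2 g p w v y)) => [w||].
- apply: smooth_on_at (sg p w v).
  by apply: open_nbhs_nbhs; split; [exact: mimg_open | exact: mimg_mloc].
- exact: endo_smooth_at.
- apply: filterS (near_chart pq (near_mdom pq)) => y [py ey _] c w z.
  by rewrite -ey /rep2 mlocK // frame_linear // gl.
Qed.

Lemma smooth_fun_at n (M : manifold R n) (mu : M -> R) p q :
  smooth_fun mu -> mdom p q -> smooth_at (mu \o minv p) (mloc p q).
Proof.
move=> smu pq; apply: smooth_on_at (smu p).
by apply: open_nbhs_nbhs; split; [exact: mimg_open | exact: mimg_mloc].
Qed.

Lemma rep1_dfun n (M : manifold R n) (mu : M -> R) p q u :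
  smooth_fun mu -> mdom p q ->
  rep1 (dfun mu) p u (mloc p q) = 'D_u (mu \o minv p) (mloc p q).
Proof.
move=> smu pq; have qq := mdom_center q; rewrite rep1E // frameE //.
have [_ sid] := smooth_map_at_id q; have ss := sid p q pq qq.
transitivity ('D_u ((mu \o minv q) \o (mloc q \o id \o minv p)) (mloc p q)).
  rewrite derive_comp_smooth //=; first by rewrite /dfun /drep mlocK.
  by rewrite mlocK //; apply: smooth_at_differentiable; exact: smooth_fun_at.
apply: near_eq_derive.
by apply: filterS (near_chart pq (near_mdom qq)) => y [_ _ qy] /=; rewrite mlocK.
Qed.

Lemma rep1_dfun_near n (M : manifold R n) (mu : M -> R) p q u :
  smooth_fun mu -> mdom p q -> \forall y \near mloc p q,
    rep1 (dfun mu) p u y = 'D_u (mu \o minv p) y.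
Proof.
move=> smu pq; apply: filterS (near_chart pq (near_mdom pq)) => y [py <- _].
exact: rep1_dfun.
Qed.

Lemma is_form1_dfun n (M : manifold R n) (mu : M -> R) :
  smooth_fun mu -> is_form1 (dfun mu).
Proof.
move=> smu; apply: is_form1I => [p|p q u pq].
  apply: derive_linear; apply: smooth_at_differentiable.
  by apply: smooth_fun_at => //; exact: mdom_center.
apply: (@smooth_at_eq _ _ _ (fun y => 'D_u (mu \o minv p) y)).
  by apply: filterS (rep1_dfun_near u smu pq) => y ->.
by apply: smooth_at_derive; exact: smooth_fun_at.
Qed.

Lemma vrep_center n (M : manifold R n) (X : vfield M) p :
  vrep X p (mloc p p) = X p.
Proof. by rewrite /vrep mlocK ?coord_center //; exact: mdom_center. Qed.

Lemma rep1_vrep_near n (M : manifold R n) (a : form1 M) (X : vfield M) p :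
  \forall y \near mloc p p,
    a (minv p y) (X (minv p y)) = rep1 a p (vrep X p y) y.
Proof.
have pp := mdom_center p.
apply: filterS (near_chart pp (near_mdom pp)) => y [py ey _].
by rewrite -ey rep1E // /vrep mlocK // frameK.
Qed.

Lemma cancel_brackets (y z t w : R) : y - z = t + y - (w + z) - (t - w).
Proof. by ring. Qed.

(** Cartan's formula.  In the chart at [p] a form evaluated on a field is a
    pairing of coordinate expressions, to which the product rule applies;
    differentiability of the fields at the single point [p] is enough. *)
Lemma dform_vfields n (M : manifold R n) (a : form1 M) (X Y : vfield M) p :
  is_form1 a ->
  differentiable (vrep X p) (mloc p p) -> differentiable (vrep Y p) (mloc p p) ->
  dform a p (X p) (Y p) =
  dfun (fun q => a q (Y q)) p (X p) - dfun (fun q => a q (X q)) p (Y p)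
  - a p (lie_bracket X Y p).
Proof.
move=> fa dX dY; have pp := mdom_center p.
have half (Z : vfield M) w : differentiable (vrep Z p) (mloc p p) ->
    dfun (fun q => a q (Z q)) p w =
    a p ('D_w (vrep Z p) (mloc p p)) + 'D_w (rep1 a p (Z p)) (mloc p p).
  move=> dZ; rewrite /dfun (near_eq_derive _ (rep1_vrep_near a Z p)).
  have dr z : derivable (rep1 a p z) (mloc p p) w.
    exact: smooth_at_derivable (form1_smooth_at z fa pp).
  have [_ ->] := is_derive_contract dr (diff_derivable dZ)
    (rep1_scalar_near fa.1 pp).
  by rewrite rep1_center vrep_center.
rewrite (half Y (X p) dY) (half X (Y p) dX).
have aB z w : a p (z - w) = a p z - a p w.
  by rewrite -scaleN1r addrC fa.1 mulN1r addrC.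
rewrite /lie_bracket aB; exact: cancel_brackets.
Qed.

End Forms.

(** * Linear systems with differentiable coefficients *)

Section LinearSystem.
Context {R : realType}.
Implicit Types V W : normedModType R.

Lemma differentiable_near V W (f g : V -> W) x :
  (\forall y \near x, f y = g y) -> differentiable f x -> differentiable g x.
Proof.
move=> fg df; have fgx := nbhs_singleton fg.
have [cd /eqaddoP key] := (diff_locallyP x f).1 df.
apply: (@differentiable_linear_approx _ _ _ g ('d f x)) => // e e0.
have sh : \forall h \near (0 : V), f (h + x) = g (h + x).
  have cx : {for (0 : V), continuous (fun h : V => h + x)}.
    by apply: cvgD; [exact: cvg_id | exact: cvg_cst].
  by apply: (cx [set y | f y = g y]); rewrite add0r.
apply: filterS2 sh (key e e0) => h <-; rewrite -fgx.
by rewrite opprD addrA.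
Qed.

Lemma differentiable_bigsum V (I : Type) (r : seq I) (F : I -> V -> R) x :
  (forall i, differentiable (F i) x) ->
  differentiable (fun y => \sum_(i <- r) F i y) x.
Proof.
move=> dF; elim: r => [|i r IH].
  rewrite (_ : (fun y => _) = cst 0); first exact: differentiable_cst.
  by apply/funext => y; rewrite big_nil.
rewrite (_ : (fun y => _) = F i + (fun y => \sum_(i <- r) F i y)).
  exact: differentiableD.
by apply/funext => y; rewrite big_cons.
Qed.

Lemma differentiable_bigprod V (I : Type) (r : seq I) (F : I -> V -> R) x :
  (forall i, differentiable (F i) x) ->
  differentiable (fun y => \prod_(i <- r) F i y) x.
Proof.
move=> dF; elim: r => [|i r IH].
  rewrite (_ : (fun y => _) = cst 1); first exact: differentiable_cst.
  by apply/funext => y; rewrite big_nil.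
rewrite (_ : (fun y => _) = F i * (fun y => \prod_(i <- r) F i y)).
  exact: differentiableM.
by apply/funext => y; rewrite big_cons.
Qed.

Lemma differentiable_mul V (f g : V -> R) x :
  differentiable f x -> differentiable g x -> differentiable (fun y => f y * g y) x.
Proof. exact: differentiableM. Qed.

Lemma differentiable_det V m (C : V -> 'M[R]_m) x :
  (forall i j, differentiable (fun y => C y i j) x) ->
  differentiable (fun y => \det (C y)) x.
Proof.
move=> dC; apply: differentiable_bigsum => s; apply: differentiable_mul.
  exact: differentiable_cst.
by apply: differentiable_bigprod => i.
Qed.

Lemma differentiable_mulmx V m p q (A : V -> 'M[R]_(m, p)) (B : V -> 'M[R]_(p, q)) x :
  (forall i j, differentiable (fun y => A y i j) x) ->
  (forall i j, differentiable (fun y => B y i j) x) ->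
  forall i j, differentiable (fun y => (A y *m B y) i j) x.
Proof.
move=> dA dB i j.
rewrite (_ : (fun y => _) = (fun y => \sum_k A y i k * B y k j)).
  by apply: differentiable_bigsum => k; apply: differentiable_mul.
by apply/funext => y; rewrite mxE.
Qed.

(** The system may have more equations than unknowns.  A right inverse [B] of
    [A x] makes the square matrix [A y *m B] invertible for [y] close to [x],
    and Cramer's rule then expresses [h y]. *)
Lemma differentiable_linear_system V m q (A : V -> 'M[R]_(m, q))
    (b : V -> 'rV[R]_q) (h : V -> 'rV[R]_m) x :
  (forall i j, differentiable (fun y => A y i j) x) ->
  (forall j, differentiable (fun y => b y 0 j) x) ->
  (\forall y \near x, h y *m A y = b y) ->
  row_free (A x) -> differentiable h x.
Proof.
move=> dA db hA /row_freeP[B AB1].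
pose C y := A y *m B.
have dB i j : differentiable (fun y : V => B i j) x by exact: differentiable_cst.
have dC : forall i j, differentiable (fun y => C y i j) x.
  exact: (differentiable_mulmx dA dB).
have db' : forall i j, differentiable (fun y => (b y *m B) i j) x.
  by apply: differentiable_mulmx => // i j; rewrite (ord1 i).
have dD : differentiable (fun y => \det (C y)) x by exact: differentiable_det.
have D1 : \det (C x) = 1 by rewrite /C AB1 det1.
have nD : \forall y \near x, \det (C y) != 0.
  have cD := differentiable_continuous dD.
  have nz : \det (C x) != 0 by rewrite D1 oner_neq0.
  exact: (@cvgr_neq0 _ R^o _ _ _ _ _ cD nz).
have dadj : forall i j, differentiable (fun y => \adj (C y) i j) x.
  move=> i j; rewrite (_ : (fun y => _) =
    (fun y => (-1) ^+ (j + i) * \det (row' j (col' i (C y))))).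
    apply: differentiable_mul; first exact: differentiable_cst.
    apply: differentiable_det => i' j'.
    by rewrite (_ : (fun y => _) = (fun y => C y (lift j i') (lift i j'))) //;
      apply/funext => y; rewrite !mxE.
  by apply/funext => y; rewrite !mxE.
have dh := differentiable_mulmx db' dadj.
apply: (@differentiable_near _ _
  (fun y => (\det (C y))^-1 *: (b y *m B *m \adj (C y)))).
  apply: filterS2 hA nD => y hAy Dy.
  rewrite -hAy -[h y *m A y *m B]mulmxA -mulmxA mul_mx_adj mul_mx_scalar.
  by rewrite scalerA mulVf // scale1r.
apply: differentiable_rV => i.
rewrite (_ : (fun y => _) =
  (fun y => (\det (C y))^-1 * (b y *m B *m \adj (C y)) 0 i)).
  apply: differentiable_mul => //.
  by apply: differentiableV => //; rewrite D1 oner_neq0.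
by apply/funext => y; rewrite mxE.
Qed.

End LinearSystem.

(** * Hessians and parallel complex structures *)

Section Kahler.
Context {R : realType}.

Lemma hessian_difference (y z a a' b c d e : R) :
  y = a - b + c -> z = a' - d + e -> a = a' -> y - z = (c - b) - (e - d).
Proof. by move=> -> -> ->; ring. Qed.

(** Let h(u, v) be the second covariant derivative of [mu] at [p], which is
    symmetric.  As [A] is parallel, d(A d mu)(u, v) = h(u, A v) - h(v, A u), and
    this is unchanged when [A u], [A v] replace [u], [v] since the square of [A]
    is minus the identity. *)
Lemma d_endo_dfun_type11 n (M : manifold R n) (A : endo M) (mu : M -> R) p Gam :
  is_endo A -> smooth_fun mu -> (forall u, A p (A p u) = - u) ->
  (forall w, linear (Gam w)) -> (forall w u, Gam w u = Gam u w) ->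
  parallel_at A p Gam ->
  forall u v,
  dform (endo_form1 A (dfun mu)) p (A p u) (A p v) =
  dform (endo_form1 A (dfun mu)) p u v.
Proof.
move=> eA smu AA lG sG parA; have pp := mdom_center p.
pose f := mu \o minv p; set x := mloc p p.
have sf : smooth_at f x by exact: smooth_fun_at.
pose df w := 'D_w f x.
have ldf : scalar df.
  by apply: derive_linear; exact: smooth_at_differentiable.
pose H a b := 'D_a (fun y => 'D_b f y) x.
have Hsym a b : H a b = H b a by exact: schwarz_at.
have HN a b : H a (- b) = - H a b.
  have dD : derivable (fun y => 'D_b f y) x a.
    exact: (smooth_at_derivable (smooth_at_derive b sf)).
  have [_ E] := is_deriveN (derivableP dD).
  rewrite /H -E; apply: near_eq_derive.
  apply: filterS (smooth_at_near sf) => y sy.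
  have lD := derive_linear (smooth_at_differentiable sy).
  have := lD (-1) b 0; rewrite addr0 scaleN1r derive0 addr0 => ->.
  by rewrite scaleN1r.
have dfN w : df (- w) = - df w.
  have := ldf (-1) w 0; rewrite addr0 scaleN1r => ->.
  by rewrite [df 0]derive0 addr0 mulN1r.
have dfB z w : df (z - w) = df z - df w.
  by rewrite -scaleN1r addrC ldf mulN1r addrC.
have GN w u : Gam w (- u) = - Gam w u.
  have G0 : Gam w 0 = 0.
    by have := lG w (-1) 0 0; rewrite scaler0 addr0 scaleN1r addNr.
  by have := lG w (-1) u 0; rewrite addr0 !scaleN1r G0 addr0.
have half w v : 'D_w (rep1 (endo_form1 A (dfun mu)) p v) x =
    df (A p (Gam w v)) - df (Gam w (A p v)) + H w (A p v).
  transitivity ('D_w (fun y => 'D_(erep A p v y) f y) x).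
    apply: near_eq_derive.
    have n1 := rep1_endo_near A (dfun mu) v pp.
    have n2 := near_chart pp (near_mdom pp).
    apply: filterS2 n1 n2 => y -> [py ey _].
    by rewrite -ey; exact: rep1_dfun.
  have dr z : derivable (fun y => 'D_z f y) x w.
    exact: (smooth_at_derivable (smooth_at_derive z sf)).
  have dh : derivable (erep A p v) x w.
    exact: (smooth_at_derivable (endo_smooth_at v eA pp)).
  have lD : \forall y \near x, scalar (fun z => 'D_z f y).
    apply: filterS (smooth_at_near sf) => y sy.
    exact: (derive_linear (smooth_at_differentiable sy)).
  have [_ ->] := is_derive_contract dr dh lD.
  rewrite erep_center -dfB /df; congr ('D_ _ f x + _).
  by apply/eqP; rewrite eq_sym subr_eq eq_sym -subr_eq0; apply/eqP; exact: parA.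
have E w v : dform (endo_form1 A (dfun mu)) p w v =
    (H w (A p v) - df (Gam w (A p v))) - (H v (A p w) - df (Gam v (A p w))).
  have E := congr1 (fun z => df (A p z)) (sG w v).
  exact: (hessian_difference (half w v) (half v w) E).
clearbody H df => {half}.
move=> u v; rewrite (E (A p u)) (E u v) !AA !HN !GN !dfN.
rewrite (Hsym (A p u)) (Hsym (A p v)) (sG (A p u)) (sG (A p v)).
move: (df _) (df _) (H _ _) (H _ _) => a b c d; ring.
Qed.

End Kahler.

(** * Maps of two variables *)

Section SplitCoordinates.
Context {R : realType}.
Variables n m : nat.

(** Identifies a product of coordinate spaces with one coordinate space, where
    C^1 maps are known to be differentiable. *)
Definition split_rV (z : 'rV[R]_(n + m)) : 'rV[R]_n * 'rV[R]_m :=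
  (lsubmx z, rsubmx z).

Lemma split_rV_is_linear : linear split_rV.
Proof. by move=> c y z; rewrite /split_rV !linearP. Qed.

HB.instance Definition _ := GRing.isLinear.Build R _ _ _ split_rV split_rV_is_linear.

Lemma split_rV_continuous : continuous split_rV.
Proof.
move=> z.
have cl : lsubmx y @[y --> z] --> lsubmx z.
  apply: (@cvg_rV _ _ (nbhs z)) => i; rewrite mxE.
  rewrite (_ : (fun y => _) = (fun y : 'rV[R]_(n + m) => y 0 (lshift m i))).
    exact: coord_continuous.
  by apply/funext => y; rewrite mxE.
have cr : rsubmx y @[y --> z] --> rsubmx z.
  apply: (@cvg_rV _ _ (nbhs z)) => i; rewrite mxE.
  rewrite (_ : (fun y => _) = (fun y : 'rV[R]_(n + m) => y 0 (rshift n i))).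
    exact: coord_continuous.
  by apply/funext => y; rewrite mxE.
exact: cvg_pair cl cr.
Qed.

Lemma smooth_at_row_mx (V : normedModType R) (f : V -> 'rV[R]_n)
    (g : V -> 'rV[R]_m) x :
  smooth_at f x -> smooth_at g x -> smooth_at (fun y => row_mx (f y) (g y)) x.
Proof.
move=> sf sg; apply: smooth_at_rV => i; case: (split_ordP i) => j ->.
  rewrite (_ : (fun y => _) = (fun y => f y 0 j)); first exact: smooth_at_coord.
  by apply/funext => y; rewrite row_mxEl.
rewrite (_ : (fun y => _) = (fun y => g y 0 j)); first exact: smooth_at_coord.
by apply/funext => y; rewrite row_mxEr.
Qed.

Lemma derive_row_mx (V : normedModType R) (f : V -> 'rV[R]_n)
    (g : V -> 'rV[R]_m) x v : smooth_at f x -> smooth_at g x ->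
  'D_v (fun y => row_mx (f y) (g y)) x = row_mx ('D_v f x) ('D_v g x).
Proof.
move=> sf sg; apply/rowP => i.
rewrite -(derive_coord i (smooth_at_derivable (smooth_at_row_mx sf sg))).
case: (split_ordP i) => j ->.
  rewrite row_mxEl -(derive_coord j (smooth_at_derivable sf)).
  by congr ('D_v _ x); apply/funext => y; rewrite row_mxEl.
rewrite row_mxEr -(derive_coord j (smooth_at_derivable sg)).
by congr ('D_v _ x); apply/funext => y; rewrite row_mxEr.
Qed.

End SplitCoordinates.

Section TwoVariables.
Context {R : realType} {n m l d : nat}.
Context {A : manifold R n} {B : manifold R m} {C : manifold R l} {P : manifold R d}.
Variables (O : set A) (f : A -> B -> C) (u : P -> A) (v : P -> B) (p : P).
Hypotheses (oO : open O) (sf : smooth_map2_on O f) (Oup : O (u p)).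
Hypotheses (su : smooth_map_at u p) (sv : smooth_map_at v p).

Let F (c : C) (x : 'rV[R]_n * 'rV[R]_m) : 'rV[R]_l :=
  mloc c (f (minv (u p) x.1) (minv (v p) x.2)).

Let s (e : P) (y : 'rV[R]_d) : 'rV[R]_(n + m) :=
  row_mx ((mloc (u p) \o u \o minv e) y) ((mloc (v p) \o v \o minv e) y).

Let continuous_comp2 : {for p, continuous (fun q => f (u q) (v q))}.
Proof.
have cuv : (u q, v q) @[q --> p] --> (u p, v p) by exact: cvg_pair su.1 sv.1.
have cf : {for (u p, v p), continuous (fun z : A * B => f z.1 z.2)} by exact: sf.1.
exact: (@continuous_comp _ _ _ (fun q => (u q, v q)) (fun z : A * B => f z.1 z.2)).
Qed.

Let F_smooth c : mdom c (f (u p) (v p)) ->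
  smooth_at (F c \o @split_rV R n m) (row_mx (mloc (u p) (u p)) (mloc (v p) (v p))).
Proof.
move=> cp.
suff H : smooth_at (F c) (mloc (u p) (u p), mloc (v p) (v p)).
  have E : @split_rV R n m (row_mx (mloc (u p) (u p)) (mloc (v p) (v p))) + 0 =
      (mloc (u p) (u p), mloc (v p) (v p)).
    by rewrite addr0 /split_rV row_mxKl row_mxKr.
  rewrite -E in H.
  have := smooth_at_affine (@split_rV_continuous R n m) H.
  by rewrite (_ : (fun y => _) = F c \o @split_rV R n m) //;
    apply/funext => y; rewrite addr0.
apply: smooth_on_at (sf.2 (u p) (v p) c).
have cf : {for (u p, v p), continuous (fun z : A * B => f z.1 z.2)} by exact: sf.1.
have cm : {for (mloc (u p) (u p), mloc (v p) (v p)), continuous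
    (fun x : 'rV[R]_n * 'rV[R]_m => (minv (u p) x.1, minv (v p) x.2))}.
  have c1 : {for mloc (u p) (u p), continuous (minv (u p))}.
    exact: minv_continuous (mimg_center _).
  have c2 : {for mloc (v p) (v p), continuous (minv (v p))}.
    exact: minv_continuous (mimg_center _).
  apply: cvg_pair.
    apply: (@continuous_comp _ _ _ (fun x : 'rV[R]_n * 'rV[R]_m => x.1)
      (minv (u p))); [exact: cvg_fst | exact: c1].
  apply: (@continuous_comp _ _ _ (fun x : 'rV[R]_n * 'rV[R]_m => x.2)
      (minv (v p))); [exact: cvg_snd | exact: c2].
have n1 : \forall x \near (mloc (u p) (u p), mloc (v p) (v p)), mimg (u p) x.1.
  apply: (@cvg_fst _ _ (nbhs (mloc (u p) (u p))) (nbhs (mloc (v p) (v p)))).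
  by apply: open_nbhs_nbhs; split; [exact: mimg_open | exact: mimg_center].
have n2 : \forall x \near (mloc (u p) (u p), mloc (v p) (v p)), mimg (v p) x.2.
  apply: (@cvg_snd _ _ (nbhs (mloc (u p) (u p))) (nbhs (mloc (v p) (v p)))).
  by apply: open_nbhs_nbhs; split; [exact: mimg_open | exact: mimg_center].
have n3 : \forall z \near (u p, v p), O z.1.
  apply: (@cvg_fst _ _ (nbhs (u p)) (nbhs (v p))).
  exact: open_nbhs_nbhs.
have n4 : \forall z \near (u p, v p), mdom c (f z.1 z.2).
  by apply: cf; exact: near_mdom.
have e1 := mlocK (mdom_center (u p)); have e2 := mlocK (mdom_center (v p)).
have n5 : \forall x \near (mloc (u p) (u p), mloc (v p) (v p)),
    O (minv (u p) x.1) /\ mdom c (f (minv (u p) x.1) (minv (v p) x.2)).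
  apply: (cm [set z | O z.1 /\ mdom c (f z.1 z.2)]); rewrite /= e1 e2.
  exact: filterI n3 n4.
apply: filterS3 n1 n2 n5 => x i1 i2 [i3 i4]; by split.
Qed.

Let s_smooth e : mdom e p -> smooth_at (s e) (mloc e p).
Proof.
move=> ep; apply: smooth_at_row_mx.
  by apply: su.2 => //; exact: mdom_center.
by apply: sv.2 => //; exact: mdom_center.
Qed.

Let s_value e : mdom e p ->
  s e (mloc e p) = row_mx (mloc (u p) (u p)) (mloc (v p) (v p)).
Proof. by move=> ep; rewrite /s /= mlocK. Qed.

Let chart_near e c : mdom e p ->
  \forall y \near mloc e p, ((F c \o @split_rV R n m) \o s e) y =
    (mloc c \o (fun q => f (u q) (v q)) \o minv e) y.
Proof.
move=> ep.
have n1 : \forall q \near p, mdom (u p) (u q).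
  by apply: su.1; apply: near_mdom; exact: mdom_center.
have n2 : \forall q \near p, mdom (v p) (v q).
  by apply: sv.1; apply: near_mdom; exact: mdom_center.
apply: filterS (near_chart ep (filterI n1 n2)) => y [_ _ [q1 q2]] /=.
by rewrite /split_rV /s row_mxKl row_mxKr /F /= !mlocK.
Qed.

Lemma smooth_map_at_comp2 : smooth_map_at (fun q => f (u q) (v q)) p.
Proof.
split=> [|e c ep cp]; first exact: continuous_comp2.
apply: smooth_at_eq (chart_near c ep) _; apply: smooth_at_comp_rV.
  exact: s_smooth.
by rewrite s_value //; exact: F_smooth.
Qed.

(** The coordinate map of the pair [(u, v)] has derivative zero along [w], and
    so has its composite with [f]. *)
Lemma tmap_comp2_eq0 w : tmap u p w = 0 -> tmap v p w = 0 ->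
  tmap (fun q => f (u q) (v q)) p w = 0.
Proof.
move=> uw vw; have pp := mdom_center p; have fp := mdom_center (f (u p) (v p)).
rewrite /tmap.
transitivity ('D_w ((F (f (u p) (v p)) \o @split_rV R n m) \o s p) (mloc p p)).
  apply: near_eq_derive.
  by apply: filterS (chart_near (f (u p) (v p)) pp) => y ->.
have dF : differentiable (F (f (u p) (v p)) \o @split_rV R n m) (s p (mloc p p)).
  by apply: smooth_at_differentiable_rV; rewrite s_value //; exact: F_smooth.
rewrite (derive_comp_smooth _ (s_smooth pp) dF).
have -> : 'D_w (s p) (mloc p p) = 0.
  rewrite (derive_row_mx w (su.2 p (u p) pp (mdom_center _))
    (sv.2 p (v p) pp (mdom_center _))).
  by rewrite /tmap in uw vw; rewrite uw vw row_mx0.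
exact: derive0.
Qed.

End TwoVariables.

Lemma smooth_map_at_cst (R : realType) n m (M : manifold R n) (N : manifold R m)
  (c : N) (p : M) : smooth_map_at (fun _ => c) p.
Proof.
split=> [|a b ap bp]; first exact: cvg_cst.
rewrite (_ : _ \o _ = (fun=> mloc b c)) //; exact: smooth_at_cst.
Qed.

(** * Lie group actions and principal bundles *)

Lemma tmap_cancel (R : realType) n m (M : manifold R n) (N : manifold R m)
    (f : M -> N) (g : N -> M) p v :
  smooth_map_at f p -> smooth_map_at g (f p) ->
  (\forall q \near p, g (f q) = q) -> tmap g (f p) (tmap f p v) = v.
Proof.
move=> sf sg gf.
exact: etrans (esym (tmap_comp v sf sg)) (etrans (tmap_near v gf) (tmap_id p v)).
Qed.

Lemma tmap0 (R : realType) n m (M : manifold R n) (N : manifold R m)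
  (f : M -> N) p : tmap f p 0 = 0.
Proof. exact: derive0. Qed.

Local Opaque tmap.

Section LieGroup.
Context {R : realType} {k : nat} (G : lie_group R k).
Implicit Types a h : G.

Lemma lmulgV h : lmul h (linv h) = lone G.
Proof.
rewrite -[LHS]lmul1g -(lmulVg (linv h)) -lmulA (lmulA (linv h) h).
by rewrite lmulVg lmul1g lmulVg.
Qed.

Lemma lmulg1 a : lmul a (lone G) = a.
Proof. by rewrite -(lmulVg a) lmulA lmulgV lmul1g. Qed.

Lemma smooth_rtrans h a : smooth_map_at (fun b => lmul b h) a.
Proof.
apply: (smooth_map_at_comp2 openT (@lmul_smooth _ _ G)) => //.
  exact: smooth_map_at_id.
exact: smooth_map_at_cst.
Qed.

Lemma tmap_rtransK h Y :
  tmap (fun b => lmul b (linv h)) h (tmap (fun b => lmul b h) (lone G) Y) = Y.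
Proof.
have E := @tmap_cancel _ _ _ _ _ (fun b => lmul b h) (fun b => lmul b (linv h))
  (lone G) Y (smooth_rtrans h _) (smooth_rtrans (linv h) _).
rewrite lmul1g in E; apply: E; apply: near_all => b.
by rewrite -lmulA lmulgV lmulg1.
Qed.

Lemma tmap_rtransVK h w :
  tmap (fun b => lmul b h) (lone G) (tmap (fun b => lmul b (linv h)) h w) = w.
Proof.
have E := @tmap_cancel _ _ _ _ _ (fun b => lmul b (linv h)) (fun b => lmul b h)
  h w (smooth_rtrans (linv h) _) (smooth_rtrans h _).
rewrite lmulgV in E; apply: E; apply: near_all => b.
by rewrite -lmulA lmulVg lmulg1.
Qed.

End LieGroup.

Section Action.
Context {R : realType} {k n : nat} {G : lie_group R k} {M : manifold R n}.
Variable act : G -> M -> M.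
Hypothesis sact : smooth_action act.

Lemma smooth_act a p : smooth_map_at (act a) p.
Proof.
apply: (smooth_map_at_comp2 openT (act_smooth sact)) => //.
  exact: smooth_map_at_cst.
exact: smooth_map_at_id.
Qed.

Lemma smooth_orbit_map p a : smooth_map_at (fun b => act b p) a.
Proof.
apply: (smooth_map_at_comp2 openT (act_smooth sact)) => //.
  exact: smooth_map_at_id.
exact: smooth_map_at_cst.
Qed.

Lemma action_field_linear p : linear (fun Y => action_field act Y p).
Proof. exact: tmap_linear (smooth_orbit_map p (lone G)). Qed.

Lemma tmap_action_field m (P : manifold R m) (f : M -> P) p Y :
  smooth_map_at f p ->
  tmap f p (action_field act Y p) = tmap (fun a => f (act a p)) (lone G) Y.
Proof.
move=> sf; have sf' : smooth_map_at f (act (lone G) p) by rewrite (act_one sact).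
have := tmap_comp Y (smooth_orbit_map p (lone G)) sf'.
by rewrite (act_one sact).
Qed.

End Action.

Section Bundle.
Context {R : realType} {k m l : nat} {G : lie_group R k}.
Context {N : manifold R m} {Q : manifold R l}.
Variables (act : G -> N -> N) (pi : N -> Q).
Hypothesis pb : principal_bundle act pi.

Let sact := pb_action pb.

Lemma smooth_pi p : smooth_map_at pi p.
Proof. exact: smooth_map_at_global (pb_smooth pb). Qed.

Lemma pi_act a p : pi (act a p) = pi p.
Proof. by apply/esym/(pb_orbits pb); exists a. Qed.

Lemma tmap_pi_action_field Y p : tmap pi p (action_field act Y p) = 0.
Proof.
rewrite (tmap_action_field sact) //; last exact: smooth_pi.
rewrite (_ : (fun a => _) = (fun=> pi p)); first exact: tmap_cst.
by apply/funext => a; rewrite pi_act.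
Qed.

Lemma tmap_pi_act a p v : tmap pi (act a p) (tmap (act a) p v) = tmap pi p v.
Proof.
apply: etrans (esym (tmap_comp v (smooth_act sact a p) (smooth_pi _))) _.
by apply: tmap_near; apply: near_all => q; rewrite /= pi_act.
Qed.

(** [tau] is the group component of a local trivialization.  Together with
    [pi] it determines the point, hence tangent vectors as well. *)
Lemma fiber_coordinate p : exists tau : N -> G,
  [/\ smooth_map_at tau p, forall a, tau (act a p) = lmul a (tau p) &
      forall w, tmap pi p w = 0 -> tmap tau p w = 0 -> w = 0].
Proof.
have [U [tau [Phi [[oU Up stau sPhi] [_ PhiK tauE]]]]] := pb_trivial pb (pi p).
have nU : \forall q \near p, U (pi q).
  by apply: (smooth_pi p).1; exact: open_nbhs_nbhs.
have st : smooth_map_at tau p.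
  apply: smooth_map_on_at stau => //.
  apply: open_comp oU => q _; exact: (smooth_pi q).1.
exists tau; split=> // [a|w piw tauw]; first exact: tauE.
have w0 := tmap_comp2_eq0 oU sPhi Up (smooth_pi p) st piw tauw.
apply: etrans (esym (tmap_id p w)) (etrans _ w0); apply: tmap_near.
by apply: filterS nU => q Uq; rewrite PhiK.
Qed.

(** [tau] turns the orbit map of [p] into the right translation by [tau p],
    which is a diffeomorphism. *)
Lemma action_field_eq0 Y p : action_field act Y p = 0 -> Y = 0.
Proof.
have [tau [st tauE _]] := fiber_coordinate p; move=> Y0.
have E := tmap_action_field sact Y st.
rewrite Y0 (_ : (fun a => _) = (fun a => lmul a (tau p))) in E; last first.
  by apply/funext => a; rewrite tauE.
rewrite -[Y](tmap_rtransK (tau p)) -E.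
by rewrite !tmap0.
Qed.

(** Some action field has the same image as [v] under the tangent map of
    [tau]; the difference is killed by the tangent maps of both [pi] and
    [tau]. *)
Lemma vertical_action_field p v : tmap pi p v = 0 ->
  exists Y, v = action_field act Y p.
Proof.
have [tau [st tauE inj]] := fiber_coordinate p; move=> piv.
(* Solves for the action field with the same image as [v] under [tau]. *)
pose Y := tmap (fun b => lmul b (linv (tau p))) (tau p) (tmap tau p v).
have tY : tmap tau p (action_field act Y p) = tmap tau p v.
  rewrite (tmap_action_field sact Y st).
  rewrite (_ : (fun a => _) = (fun a => lmul a (tau p))).
    exact: tmap_rtransVK.
  by apply/funext => a; rewrite tauE.
exists Y; apply/eqP; rewrite -subr_eq0; apply/eqP; apply: inj.
  rewrite -scaleN1r addrC (tmap_linear (smooth_pi p)) piv tmap_pi_action_field.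
  by rewrite scaler0 addr0.
by rewrite -scaleN1r addrC (tmap_linear st) tY scaleN1r addNr.
Qed.

Lemma local_section p : exists s : Q -> N, s (pi p) = p /\
  \forall x \near pi p, smooth_map_at s x /\ pi (s x) = x.
Proof.
have [U [tau [Phi [[oU Up stau sPhi] [PhiE PhiK _]]]]] := pb_trivial pb (pi p).
exists (fun x => Phi x (tau p)); split; first exact: PhiK.
apply: filterS (open_nbhs_nbhs (conj oU Up)) => x Ux; split.
  apply: (smooth_map_at_comp2 oU sPhi) => //.
    exact: smooth_map_at_id.
  exact: smooth_map_at_cst.
by have [] := PhiE x (tau p) Ux.
Qed.

Lemma tmap_section (s : Q -> N) x u :
  (\forall y \near x, smooth_map_at s y /\ pi (s y) = y) ->
  tmap pi (s x) (tmap s x u) = u.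
Proof.
move=> H; have [ss sx] := nbhs_singleton H.
apply: (tmap_cancel u ss (smooth_pi _)).
by apply: filterS H => y [].
Qed.

Lemma tmap_pi_surj p u : exists v, tmap pi p v = u.
Proof.
have [s [sp Hs]] := local_section p.
by exists (tmap s (pi p) u); rewrite -{1}sp; exact: tmap_section.
Qed.

End Bundle.

Local Opaque derive tmap.

(** * Horizontal lifts *)

Section HorizontalLifts.
Context {R : realType} {k m l : nat} {G : lie_group R k}.
Context {N : manifold R m} {Q : manifold R l}.
Variables (act : G -> N -> N) (pi : N -> Q) (gN : form2 N).
Hypothesis pb : principal_bundle act pi.
Hypotheses (gr : forall p u, scalar (gN p u))
  (gl : forall p v, scalar (fun u => gN p u v))
  (gpos : forall p u, u != 0 -> 0 < gN p u u).

Let sact := pb_action pb.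
Local Notation afield := (action_field act).
Local Notation hor := (horizontal act gN).
Local Notation hl := (hlift act pi gN).

Lemma form2Bl p u v w : gN p (u - v) w = gN p u w - gN p v w.
Proof. by rewrite -scaleN1r addrC (gl p w) mulN1r addrC. Qed.

Lemma form2_eq0 p u : gN p u u = 0 -> u = 0.
Proof.
by move=> g0; apply/eqP/negP => /negP /(gpos p); rewrite g0 ltxx.
Qed.

Lemma form2_action_sum p v Y :
  gN p v (afield Y p) = \sum_j Y 0 j * gN p v (afield (delta_mx 0 j) p).
Proof.
have lphi : scalar (fun Z => gN p v (afield Z p)).
  by move=> c Z Z'; rewrite (action_field_linear sact p) gr.
exact: scalar_sum_delta lphi.
Qed.

Lemma horizontal_basis p v :
  (forall j, gN p v (afield (delta_mx 0 j) p) = 0) -> hor p v.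
Proof.
by move=> H Y; rewrite form2_action_sum big1 // => j _; rewrite H mulr0.
Qed.

Lemma horizontal0 p : hor p 0.
Proof. by move=> Y; have := form2Bl p 0 0 (afield Y p); rewrite subr0 subrr. Qed.

Lemma horizontal_linear p c u v : hor p u -> hor p v -> hor p (c *: u + v).
Proof. by move=> hu hv Y; rewrite (gl p) hu hv mulr0 addr0. Qed.

(** The Gram matrix of the action fields of a basis is invertible, because the
    metric is positive and a nonzero [Y] has a nonzero action field. *)
Lemma vertical_projection p v : exists Y, hor p (v - afield Y p).
Proof.
pose Gr := \matrix_(i, j) gN p (afield (delta_mx 0 i) p) (afield (delta_mx 0 j) p).
have GrE Y j : (Y *m Gr) 0 j = gN p (afield Y p) (afield (delta_mx 0 j) p).
  have lphi : scalar (fun Z => gN p (afield Z p) (afield (delta_mx 0 j) p)).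
    by move=> c Z Z'; rewrite (action_field_linear sact p) gl.
  rewrite (scalar_sum_delta Y lphi) mxE; apply: eq_bigr => i _.
  by rewrite mxE.
have Gru : Gr \in unitmx.
  rewrite -row_free_unit -kermx_eq0; apply/rowV0P => Y /sub_kermxP Y0.
  apply: (action_field_eq0 pb (p := p)); apply: (form2_eq0 (p := p)).
  by apply: horizontal_basis => j; rewrite -GrE Y0 mxE.
exists ((\row_j gN p v (afield (delta_mx 0 j) p)) *m invmx Gr).
apply: horizontal_basis => j; rewrite form2Bl -GrE mulmxKV // mxE.
exact: subrr.
Qed.

(** The difference of two horizontal lifts of a vector is vertical, hence
    orthogonal to itself. *)
Lemma horizontal_inj p v w : hor p v -> hor p w ->
  tmap pi p v = tmap pi p w -> v = w.
Proof.
move=> hv hw pivw; apply/eqP; rewrite -subr_eq0; apply/eqP.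
have hvw : hor p (v - w).
  by move=> Y; rewrite form2Bl hv hw subr0.
have [|Y E] := vertical_action_field pb (p := p) (v := v - w).
  by rewrite -scaleN1r addrC (tmap_linear (smooth_pi pb p)) pivw scaleN1r addNr.
by apply: (form2_eq0 (p := p)); rewrite {2}E hvw.
Qed.

Lemma hlift_spec p u : hor p (hl p u) /\ tmap pi p (hl p u) = u.
Proof.
have [v vu] := tmap_pi_surj pb p u; have [Y hY] := vertical_projection p v.
apply: (@xgetPex _ 0 [set v | hor p v /\ tmap pi p v = u]).
exists (v - afield Y p); split; first exact: hY.
rewrite -scaleN1r addrC (tmap_linear (smooth_pi pb p)) vu.
by rewrite (tmap_pi_action_field pb) scaler0 add0r.
Qed.

Lemma hlift_horizontal p u : hor p (hl p u).
Proof. by have [] := hlift_spec p u. Qed.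

Lemma tmap_hlift p u : tmap pi p (hl p u) = u.
Proof. by have [] := hlift_spec p u. Qed.

Lemma hliftK p v : hor p v -> hl p (tmap pi p v) = v.
Proof.
move=> hv; exact: horizontal_inj (hlift_horizontal _ _) hv (tmap_hlift _ _).
Qed.

Lemma hlift_linear p : linear (hl p).
Proof.
move=> c u v; apply: (@horizontal_inj p); first exact: hlift_horizontal.
  by apply: horizontal_linear; exact: hlift_horizontal.
by rewrite (tmap_linear (smooth_pi pb p)) !tmap_hlift.
Qed.

Hypothesis (eta : 'rV[R]_k -> form1 N).
Hypotheses (feta : forall Y, is_form1 (eta Y))
  (etaE : forall Y p v, eta Y p v = gN p v (afield Y p)).

(** In the chart at [p] the lift solves a linear system: its projection by [pi]
    is prescribed, and it pairs to zero with the forms [eta], which are the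
    metric duals of the action fields.  The system is injective because
    horizontal lifts are unique. *)
Lemma differentiable_hlift_field (O : set Q) (U : vfield Q) p :
  open O -> O (pi p) -> smooth_vfield_on O U ->
  differentiable (vrep (hlift_field act pi gN U) p) (mloc p p).
Proof.
move=> oO Op sU; have pp := mdom_center p; have rr := mdom_center (pi p).
set r := pi p in rr Op *; set x := mloc p p; set h := vrep _ p.
pose s := mloc r \o pi \o minv p.
have ss : smooth_at s x by exact: (smooth_pi pb p).2.
have sx : s x = mloc r r by rewrite /s /x /= mlocK.
(* The first [l] equations prescribe the projection, the last [k] express
   horizontality. *)
pose A y : 'M[R]_(m, l + k) := row_mx (\matrix_(i, j) 'D_(delta_mx 0 i) s y 0 j)
  (\matrix_(i, j) rep1 (eta (delta_mx 0 j)) p (delta_mx 0 i) y).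
pose b y : 'rV[R]_(l + k) := row_mx (vrep U r (s y)) 0.
have ds y (v : 'rV[R]_m) : smooth_at s y ->
    v *m (\matrix_(i, j) 'D_(delta_mx 0 i) s y 0 j) = 'D_v s y.
  move=> sy; apply/rowP => j.
  rewrite (derive_sum_delta v (smooth_at_differentiable_rV sy)).
  by rewrite mxE summxE; apply: eq_bigr => i _; rewrite !mxE.
have de p' (v : 'rV[R]_m) : mdom p p' ->
    v *m (\matrix_(i, j) rep1 (eta (delta_mx 0 j)) p (delta_mx 0 i) (mloc p p')) =
    \row_j rep1 (eta (delta_mx 0 j)) p v (mloc p p').
  move=> dp'; apply/rowP => j; rewrite !mxE.
  rewrite (scalar_sum_delta v (rep1_scalar (feta (delta_mx 0 j)).1 dp')).
  by apply: eq_bigr => i _; rewrite !mxE.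
apply: (@differentiable_linear_system _ _ _ _ A b h).
- move=> i j; case: (split_ordP j) => j' ->.
    rewrite (_ : (fun y => _) = (fun y => 'D_(delta_mx 0 i) s y 0 j')).
      exact: (smooth_at_differentiable (smooth_at_coord j' (smooth_at_derive _ ss))).
    by apply/funext => y; rewrite row_mxEl mxE.
  rewrite (_ : (fun y => _) =
      (fun y => rep1 (eta (delta_mx 0 j')) p (delta_mx 0 i) y)).
    exact: (smooth_at_differentiable (form1_smooth_at _ (feta _) pp)).
  by apply/funext => y; rewrite row_mxEr mxE.
- move=> j; case: (split_ordP j) => j' ->; last first.
    rewrite (_ : (fun y => _) = cst 0); first exact: differentiable_cst.
    by apply/funext => y; rewrite row_mxEr mxE.
  rewrite (_ : (fun y => _) = (fun y => vrep U r (s y) 0 j')); last first.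
    by apply/funext => y; rewrite row_mxEl.
  apply: smooth_at_differentiable.
  have sv : smooth_at (vrep U r) (s x).
    rewrite sx; apply: smooth_on_at (sU r).
    have nO : \forall q \near r, O q by exact: open_nbhs_nbhs.
    apply: filterS (near_chart rr nO) => y [ry ey Oy].
    by split=> //; rewrite -ey; exact: mimg_mloc.
  exact: (smooth_at_coord j' (smooth_at_comp_rV ss sv)).
- have nr : \forall q \near p, mdom r (pi q).
    by apply: (smooth_pi pb p).1; exact: near_mdom.
  apply: filterS2 (smooth_at_near ss) (near_chart pp nr) => y sy [py ey ry].
  rewrite mul_mx_row (ds _ _ sy); set p' := minv p y in py ey ry.
  have hE : h y = coord p p' (hl p' (U (pi p'))) by [].
  apply: (congr2 (@row_mx _ 1 l k)).
    have E := drep_coord (h y) (smooth_pi pb p') py ry.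
    rewrite {2}hE (frameK _ py) tmap_hlift in E.
    rewrite /drep ey in E; rewrite E /s /vrep.
    by rewrite /= (mlocK ry).
  rewrite -ey (de _ _ py) ey; apply/rowP => j; rewrite !mxE.
  rewrite -[X in rep1 _ _ _ X]ey (rep1E _ _ py) hE (frameK _ py) etaE.
  exact: hlift_horizontal.
- rewrite -kermx_eq0; apply/rowV0P => v /sub_kermxP.
  rewrite mul_mx_row (ds _ _ ss) (de _ _ pp) => /eqP.
  rewrite row_mx_eq0 => /andP[/eqP tv /eqP ev].
  apply: (@horizontal_inj p).
  + apply: horizontal_basis => j; rewrite -etaE -rep1_center.
    by move/rowP: ev => /(_ j); rewrite !mxE.
  + exact: horizontal0.
  + by rewrite tmap0.
Qed.

(** These fields extend any tangent vector locally, which is how the curvature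
    gets evaluated. *)
Lemma smooth_constant_field q u :
  smooth_vfield_on (mdom q) (fun x : Q => frame q (mloc q x) u).
Proof.
move=> r; apply: smooth_at_on => _ [[x rx <-]]; rewrite mlocK // => qx.
have [_ sid] := smooth_map_at_id x.
have st := sid q r qx rx; have st' := sid r q rx qx.
apply: (@smooth_at_eq _ _ _ ((fun z => 'D_u (mloc r \o id \o minv q) z) \o
    (mloc q \o id \o minv r))).
  apply: filterS (near_chart rx (near_mdom qx)) => y [ry ey qy].
  rewrite /vrep /=; set x' := minv r y in ry ey qy *.
  rewrite (frameE _ qy) coordE.
  have sid' := smooth_map_at_id x'.
  have E := drep_comp sid' sid' u qy (mdom_center x') ry.
  exact: (etrans _ E).
apply: smooth_at_comp_rV => //.
by rewrite /= mlocK //; exact: smooth_at_derive.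
Qed.

End HorizontalLifts.

(** * The hyperkaehler quotient *)

Lemma dfun_cst (R : realType) n (M : manifold R n) (c : R) (p : M) v :
  dfun (fun _ : M => c) p v = 0.
Proof. exact: derive_cst. Qed.

Local Opaque dform dfun lie_bracket hlift.

Section AlgebraOfForms.
Context {R : realType} {n : nat} {M : manifold R n}.

Lemma bilinear_field_sub (a b : form2 M) :
  is_bilinear_field a -> is_bilinear_field b ->
  is_bilinear_field (fun p u v => a p u v - b p u v).
Proof.
move=> [ar al sa] [br bl sb]; split=> [p u c v w|p v c u w|p u v].
- exact: sub_combination (ar p u c v w) (br p u c v w).
- exact: sub_combination (al p v c u w) (bl p v c u w).
apply: smooth_at_on => _ [q pq <-].
have nq : nbhs (mloc p q) (mimg p).
  by apply: open_nbhs_nbhs; split; [exact: mimg_open | exact: mimg_mloc].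
by apply: smooth_atB;
  [exact: smooth_on_at nq (sa p u v) | exact: smooth_on_at nq (sb p u v)].
Qed.

Lemma scalarN (V : lmodType R) (phi : V -> R) v : scalar phi -> phi (- v) = - phi v.
Proof.
move=> lphi; have phi0 : phi 0 = 0.
  by have := lphi (-1) 0 0; rewrite scaler0 addr0 mulN1r addNr.
by have := lphi (-1) v 0; rewrite addr0 scaleN1r phi0 addr0 mulN1r.
Qed.

(** [A] multiplies both arguments by i, or both by -i, so that invariance
    equates the complexified value of [F] with its opposite. *)
Lemma invariant_type11 (A : endo M) (F : form2 M) :
  is_bilinear_field F -> (forall p u v, F p (A p u) (A p v) = F p u v) ->
  type11 A F.
Proof.
move=> [Fr Fl _] FA p [z1 z2] [w1 w2] H; rewrite /complexify2 /=.
have E1 : F p z1 w1 = F p z2 w2.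
  rewrite -FA; case: H => -[[/= -> _] [/= -> _]] //.
  by rewrite (scalarN _ (Fr p _)) (scalarN _ (Fl p _)) opprK.
have E2 : F p z1 w2 = - F p z2 w1.
  rewrite -FA; case: H => -[[/= -> _] [/= _ ->]].
    by rewrite (scalarN _ (Fl p _)).
  by rewrite (scalarN _ (Fr p _)).
by rewrite E1 E2 subrr addNr.
Qed.

End AlgebraOfForms.

Lemma cancel_derivatives (R : realType) (s t y1 y2 z1 z2 b c : R) :
  s = y1 - y2 - b -> t = z1 - z2 - c -> y1 = z1 -> y2 = z2 -> s - t = c - b.
Proof. by move=> -> -> -> ->; ring. Qed.

Lemma sub_shift (R : realType) (b c : R) : b - (-1 * c + b) = c.
Proof. by ring. Qed.

Section Quotient.
Context {R : realType} {k n m l : nat} {G : lie_group R k}.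
Context {M : manifold R n} {N : manifold R m} {Q : manifold R l}.
Variables (g : form2 M) (I J K : endo M) (act : G -> M -> M)
  (muI muJ muK : M -> 'rV[R]_k -> R)
  (iota : N -> M) (actN : G -> N -> N) (pi : N -> Q)
  (gh : form2 Q) (Ih Jh Kh : endo Q).
Hypotheses (hk : hyperkahler g I J K) (sact : smooth_action act)
  (muI_moment : moment_map act (kahler_form g I) muI)
  (muJ_moment : moment_map act (kahler_form g J) muJ)
  (muK_moment : moment_map act (kahler_form g K) muK)
  (hq : hyperkahler_quotient g I J K act muI muJ muK
          iota actN pi gh Ih Jh Kh).

Let pb := hq_bundle hq.
Let sactN := pb_action pb.
Let gN := pullback2 iota g.
Local Notation afield := (action_field act).
Local Notation afieldN := (action_field actN).
Local Notation hor := (horizontal actN gN).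
Local Notation hl := (hlift actN pi gN).

Let gr p u : scalar (g p u). Proof. by have [[]] := hk_metric hk. Qed.
Let gl p v : scalar (fun u => g p u v). Proof. by have [[]] := hk_metric hk. Qed.
Let gsym p u v : g p u v = g p v u. Proof. by have [] := hk_metric hk. Qed.
Let gpos p u : u != 0 -> 0 < g p u u. Proof. by have [_ _] := hk_metric hk; exact. Qed.

Lemma smooth_iota p : smooth_map_at iota p.
Proof. exact: smooth_map_at_global (emb_smooth (hq_level hq)). Qed.

Let gNr p u : scalar (gN p u).
Proof. by move=> c v w; rewrite /gN /pullback2 (tmap_linear (smooth_iota p)) gr. Qed.

Let gNl p v : scalar (fun u => gN p u v).
Proof. by move=> c u w; rewrite /gN /pullback2 (tmap_linear (smooth_iota p)) gl. Qed.

Let gNpos p u : u != 0 -> 0 < gN p u u.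
Proof.
move=> u0; apply: gpos; apply: contra_neq u0 => tu0.
by apply: (emb_immersion (hq_level hq) (p := p)); rewrite tu0 tmap0.
Qed.

Lemma tmap_iota_action_field Y p :
  tmap iota p (afieldN Y p) = afield Y (iota p).
Proof.
have E : (fun a => iota (actN a p)) = (fun a => act a (iota p)).
  by apply/funext => a; rewrite (hq_act hq).
exact: etrans (tmap_action_field sactN Y (smooth_iota p))
  (congr1 (fun f => tmap f (lone G) Y) E).
Qed.

(** The metric dual of the action field of [Y]. *)
Definition orbit_form (Y : 'rV[R]_k) : form1 M := fun p v => g p (afield Y p) v.

(** For all three complex structures at once: the metric pairing of the action
    field with [v] is that of their images by [A], which is the Kaehler form of
    [A] on the action field and [A v], and this is d mu (A v). *)
Lemma moment_orbit_form (A : endo M) mu Y : almost_hermitian g A ->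
  moment_map act (kahler_form g A) mu ->
  endo_form1 A (dfun (fun q => mu q Y)) = orbit_form Y.
Proof.
move=> [_ _ gA] mm; apply/funext => p; apply/funext => v.
by rewrite /endo_form1 (mu_hamiltonian mm) /kahler_form gA.
Qed.

Lemma is_form1_orbit_form Y : is_form1 (orbit_form Y).
Proof.
rewrite -(moment_orbit_form Y (hk_I hk) muI_moment).
apply: is_form1_endo; first by have [] := hk_I hk.
exact: is_form1_dfun (mu_smooth muI_moment Y).
Qed.

Lemma d_orbit_form_invariant (A : endo M) mu p : almost_hermitian g A ->
  moment_map act (kahler_form g A) mu ->
  (exists Gam, levi_civita_at g p Gam /\ parallel_at A p Gam) ->
  forall Y u v, dform (orbit_form Y) p (A p u) (A p v) = dform (orbit_form Y) p u v.
Proof.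
move=> hA mm [Gam [[lG sG _] pA]] Y u v.
rewrite -(moment_orbit_form Y hA mm); have [eA AA _] := hA.
exact: (d_endo_dfun_type11 eA (mu_smooth mm Y) (AA p) lG sG pA).
Qed.

Let etaN Y := pullback1 iota (orbit_form Y).

Let etaNE Y p v : etaN Y p v = gN p v (afieldN Y p).
Proof.
rewrite /etaN /pullback1 /orbit_form -tmap_iota_action_field; exact: gsym.
Qed.

Let fetaN Y : is_form1 (etaN Y).
Proof.
exact: is_form1_pullback1 (emb_smooth (hq_level hq)) (is_form1_orbit_form Y).
Qed.

Let hl_hor p u : hor p (hl p u).
Proof. exact: hlift_horizontal pb gNr gNl gNpos p u. Qed.

Let tmap_hl p u : tmap pi p (hl p u) = u.
Proof. exact: tmap_hlift pb gNr gNl gNpos p u. Qed.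

Let diff_hl (B : set Q) (U : vfield Q) p : open B -> B (pi p) ->
  smooth_vfield_on B U ->
  differentiable (vrep (hlift_field actN pi gN U) p) (mloc p p).
Proof. exact: (differentiable_hlift_field pb gNr gNl gNpos fetaN etaNE). Qed.

(** Cartan's formula for the metric dual of an action field, which vanishes on
    horizontal fields.  The right-hand side involves [U] and [W] only through
    their values at [pi p]. *)
Lemma vertical_bracket (B : set Q) (U W : vfield Q) p Z :
  open B -> B (pi p) -> smooth_vfield_on B U -> smooth_vfield_on B W ->
  gN p (lie_bracket (hlift_field actN pi gN U) (hlift_field actN pi gN W) p)
    (afieldN Z p) =
  - dform (etaN Z) p (hl p (U (pi p))) (hl p (W (pi p))).
Proof.
move=> oB Bp sU sW.
have := dform_vfields (fetaN Z) (diff_hl oB Bp sU) (diff_hl oB Bp sW).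
have z X : (fun q => etaN Z q (hlift_field actN pi gN X q)) = (fun=> 0).
  by apply/funext => q; rewrite etaNE; exact: hl_hor.
rewrite (z W) (z U) !dfun_cst subrr sub0r etaNE => E.
exact: etrans (esym (opprK _)) (congr1 -%R (esym E)).
Qed.

Let Omega := curvature actN pi gN.

(** The vertical part found for one pair of extensions of [u] and [w] serves
    for all of them by [vertical_bracket], so the set from which [curvature]
    chooses is nonempty. *)
Lemma curvature_spec p u w (B : set Q) (U W : vfield Q) :
  open B -> B (pi p) -> smooth_vfield_on B U -> smooth_vfield_on B W ->
  U (pi p) = u -> W (pi p) = w ->
  hor p (lie_bracket (hlift_field actN pi gN U) (hlift_field actN pi gN W) p
         - afieldN (Omega p u w) p).
Proof.
move: B U W.
apply: (@xgetPex _ 0 [set Y | forall (B : set Q) (U W : vfield Q),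
    open B -> B (pi p) -> smooth_vfield_on B U -> smooth_vfield_on B W ->
    U (pi p) = u -> W (pi p) = w ->
    hor p (lie_bracket (hlift_field actN pi gN U) (hlift_field actN pi gN W) p
           - afieldN Y p)]).
pose q := pi p; pose U0 x := frame q (mloc q x) u; pose W0 x := frame q (mloc q x) w.
have [Y HY] := vertical_projection pb gNr gNl gNpos p
  (lie_bracket (hlift_field actN pi gN U0) (hlift_field actN pi gN W0) p).
have oq := @mdom_open _ _ Q q; have qq := mdom_center q.
exists Y => B U W oB Bp sU sW Up Wp Z.
have E0 := vertical_bracket Z oq qq (smooth_constant_field q u)
  (smooth_constant_field q w).
have E1 := vertical_bracket Z oB Bp sU sW.
have fc x : frame q (mloc q q) x = x := frame_center q x.
rewrite fc fc in E0; rewrite Up Wp in E1.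
apply: etrans (form2Bl gNl _ _ _ _) _.
rewrite (etrans E1 (esym E0)).
exact: etrans (esym (form2Bl gNl _ _ _ _)) (HY Z).
Qed.

(** The curvature as minus the exterior derivative of the connection, paired
    with [Z]. *)
Lemma curvature_orbit_form p u w Z :
  gN p (afieldN (Omega p u w) p) (afieldN Z p) =
  - dform (etaN Z) p (hl p u) (hl p w).
Proof.
pose q := pi p; have oq := @mdom_open _ _ Q q; have qq := mdom_center q.
have fc x : frame q (mloc q q) x = x := frame_center q x.
have H := curvature_spec oq qq (smooth_constant_field q u)
  (smooth_constant_field q w) (fc u) (fc w) (p := p).
have E := vertical_bracket Z oq qq (smooth_constant_field q u)
  (smooth_constant_field q w).
rewrite fc fc in E.
move/eqP: (etrans (esym (form2Bl gNl _ _ _ _)) (H Z)).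
rewrite subr_eq0 => /eqP <-; exact: E.
Qed.

(** The two vertical vectors have the same inner products with all action
    fields. *)
Lemma curvature_invariant (A : endo M) (Ah : endo Q) mu p u w :
  almost_hermitian g A -> moment_map act (kahler_form g A) mu ->
  (exists Gam, levi_civita_at g (iota p) Gam /\ parallel_at A (iota p) Gam) ->
  induced_endo iota actN pi gN A Ah ->
  afieldN (Omega p (Ah (pi p) u) (Ah (pi p) w)) p = afieldN (Omega p u w) p.
Proof.
move=> hA mm par ind; apply/eqP; rewrite -subr_eq0; apply/eqP.
set Y1 := Omega _ _ _; set Y2 := Omega _ _ _.
have E Z : gN p (afieldN Y1 p) (afieldN Z p) = gN p (afieldN Y2 p) (afieldN Z p).
  have d a b : dform (etaN Z) p a b =
      dform (orbit_form Z) (iota p) (tmap iota p a) (tmap iota p b).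
    exact: dform_pullback1 p a b (emb_smooth (hq_level hq)) (is_form1_orbit_form Z).
  have inv := etrans (congr2 (dform (orbit_form Z) (iota p)) (ind p u) (ind p w))
    (d_orbit_form_invariant hA mm par Z _ _).
  have E := etrans (d _ _) (etrans inv (esym (d _ _))).
  exact: etrans (curvature_orbit_form _ _ _ _)
    (etrans (congr1 -%R E) (esym (curvature_orbit_form _ _ _ _))).
have Ysub : afieldN Y1 p - afieldN Y2 p = afieldN (Y1 - Y2) p.
  by rewrite -scaleN1r addrC -(action_field_linear sactN) scaleN1r addrC.
apply: (form2_eq0 gNpos (p := p)); rewrite {2}Ysub (form2Bl gNl) E.
exact: subrr.
Qed.

Section BasicForm.
Variable alpha : form1 M.
Hypotheses (falpha : is_form1 alpha) (balpha : basic_form1 act alpha)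
  (dalpha : forall p u v, dform alpha p u v = 0).

Let alphaN := pullback1 iota alpha.

Let falphaN : is_form1 alphaN.
Proof. exact: is_form1_pullback1 (emb_smooth (hq_level hq)) falpha. Qed.

Let alphaN_vertical Y p : alphaN p (afieldN Y p) = 0.
Proof. by rewrite /alphaN /pullback1 tmap_iota_action_field balpha.2. Qed.

Let alphaN_invariant a p v :
  alphaN (actN a p) (tmap (actN a) p v) = alphaN p v.
Proof.
rewrite /alphaN /pullback1.
have <- := tmap_comp v (smooth_act sactN a p) (smooth_iota _).
have E : iota \o actN a = act a \o iota.
  by apply/funext => q /=; rewrite (hq_act hq).
rewrite E (tmap_comp v (smooth_iota p) (smooth_act sact a _)) (hq_act hq).
exact: balpha.1.
Qed.

(** The chosen point of the fibre does not matter, by [descended_formE]. *)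
Definition descended_form : form1 Q := fun q u =>
  let p := sval (cid (pb_surjective pb q)) in
  pullback1 iota alpha p (hlift actN pi (pullback2 iota g) p u).

Local Notation alphah := descended_form.

(** After a translation along the orbit two lifts of a tangent vector differ by
    a vertical vector, and a basic form sees neither the translation nor the
    vertical vector. *)
Lemma descended_formE p v : alphah (pi p) (tmap pi p v) = alphaN p v.
Proof.
rewrite /descended_form; case: (cid _) => p' /= pp'.
have [a pE] := (pb_orbits pb p' p).1 pp'; move: v; rewrite {p pp'}pE => v.
(* [w] lifts the vector at [p']; its translate and [v] lift it at the same
   point. *)
set w := hl p' _.
have pw : tmap pi (actN a p') (v - tmap (actN a) p' w) = 0.
  rewrite -scaleN1r addrC (tmap_linear (smooth_pi pb _)) (tmap_pi_act pb).
  by rewrite tmap_hl scaleN1r addNr.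
have [Y EY] := vertical_action_field pb pw.
rewrite -[v](subrK (tmap (actN a) p' w)) EY.
have := falphaN.1 (actN a p') 1 (afieldN Y (actN a p')) (tmap (actN a) p' w).
by rewrite scale1r mul1r alphaN_vertical add0r alphaN_invariant.
Qed.

Lemma pullback_descended_form : pullback1 pi alphah = alphaN.
Proof. by apply/funext => p; apply/funext => v; exact: descended_formE. Qed.

(** Near any point the form is the pullback of [alphaN] by a local section of
    [pi]. *)
Lemma is_form1_descended_form : is_form1 alphah.
Proof.
apply: is_form1I => [q c u v|b q u bq].
  rewrite /descended_form (hlift_linear pb gNr gNl gNpos).
  exact: falphaN.1.
have [p pq] := pb_surjective pb q; have [s [sp Hs]] := local_section pb p.
rewrite pq in Hs; have [B [oB Bq HB]] := near_open Hs.
have ns : \forall x \near q, smooth_map_at s x by apply: filterS Hs => x [].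
apply: smooth_at_eq (smooth_at_pullback1 ns falphaN u bq).
have nB : \forall x \near q, B x by exact: open_nbhs_nbhs.
apply: filterS (near_chart bq nB) => y [by1 ey By].
rewrite -ey !(rep1E _ _ by1); set x := minv b y in by1 ey By *.
have nx : \forall x' \near x, smooth_map_at s x' /\ pi (s x') = x'.
  by apply: filterS (open_nbhs_nbhs (conj oB By)); exact: HB.
have [_ sx] := HB x By.
set w := frame b _ u; apply: etrans (esym (descended_formE _ _)) _.
by rewrite (tmap_section pb w nx) sx.
Qed.

Lemma d_descended_form q u v : dform alphah q u v = 0.
Proof.
have [p <-] := pb_surjective pb q.
rewrite -(tmap_hl p u) -(tmap_hl p v).
apply: etrans (esym (dform_pullback1 p _ _ (pb_smooth pb)
  is_form1_descended_form)) _.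
rewrite pullback_descended_form.
apply: etrans (dform_pullback1 _ _ _ (emb_smooth (hq_level hq)) falpha) _.
exact: dalpha.
Qed.

Section OneStructure.
Variables (A : endo M) (Ah : endo Q) (alpha_g : 'rV[R]_k -> R).
Hypotheses (hA : almost_hermitian g A) (eAh : is_endo Ah)
  (ind : induced_endo iota actN pi gN A Ah)
  (dA : forall p u v, dform (endo_form1 A alpha) p u v = kahler_form g A p u v)
  (agE : forall Y p, endo_form1 A alpha (iota p) (afield Y (iota p)) = alpha_g Y).

Let gh_metric : is_metric gh. Proof. by have [] := hq_tensors hq. Qed.
Let eA : is_endo A. Proof. by have [] := hA. Qed.

Let betaN := pullback1 iota (endo_form1 A alpha).

Let fA : is_form1 (endo_form1 A alpha).
Proof. exact: is_form1_endo eA falpha. Qed.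

Let fbetaN : is_form1 betaN.
Proof. exact: is_form1_pullback1 (emb_smooth (hq_level hq)) fA. Qed.

Let fAh : is_form1 (endo_form1 Ah alphah).
Proof. exact: is_form1_endo eAh is_form1_descended_form. Qed.

Let gamma := pullback1 pi (endo_form1 Ah alphah).

Let fgamma : is_form1 gamma.
Proof. exact: is_form1_pullback1 (pb_smooth pb) fAh. Qed.

Let gammaE p v : gamma p v = betaN p (hl p (tmap pi p v)).
Proof.
rewrite /gamma /pullback1 /endo_form1.
rewrite -[Ah _ _](tmap_hl p) descended_formE /alphaN /pullback1 ind.
by [].
Qed.

Let betaN_vertical p Y : betaN p (afieldN Y p) = alpha_g Y.
Proof. by rewrite /betaN /pullback1 tmap_iota_action_field agE. Qed.

Definition curvature_form : form2 Q := fun q u v =>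
  dform (endo_form1 Ah alphah) q u v - kahler_form gh Ah q u v.

Lemma kahler_form_quotient p u v :
  kahler_form gh Ah (pi p) u v =
  kahler_form g A (iota p) (tmap iota p (hl p u)) (tmap iota p (hl p v)).
Proof.
by rewrite /kahler_form (hq_metric hq) /pullback2 ind.
Qed.

(** Cartan's formula for the two forms [gamma] and [betaN] on N, which agree on
    horizontal lifts: only the bracket terms differ, by the value of [betaN] on
    the vertical part of the bracket. *)
Lemma curvature_formE p u w : curvature_form (pi p) u w = alpha_g (Omega p u w).
Proof.
rewrite /curvature_form kahler_form_quotient.
have E1 := dform_pullback1 p (hl p u) (hl p w) (pb_smooth pb) fAh.
rewrite !tmap_hl in E1; rewrite -E1.
have E2 := dform_pullback1 p (hl p u) (hl p w) (emb_smooth (hq_level hq)) fA.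
rewrite dA in E2; rewrite -E2 -/gamma -/betaN.
pose q := pi p; have oq := @mdom_open _ _ Q q; have qq := mdom_center q.
have fc x : frame q (mloc q q) x = x := frame_center q x.
have sU := @smooth_constant_field _ _ Q q u; have sW := @smooth_constant_field _ _ Q q w.
set U := (fun x : Q => frame q (mloc q x) u) in sU.
set W := (fun x : Q => frame q (mloc q x) w) in sW.
pose X := hlift_field actN pi gN U; pose Y := hlift_field actN pi gN W.
have Xp : X p = hl p u by rewrite /X /hlift_field /U fc.
have Yp : Y p = hl p w by rewrite /Y /hlift_field /W fc.
have dX : differentiable (vrep X p) (mloc p p) := diff_hl oq qq sU.
have dY : differentiable (vrep Y p) (mloc p p) := diff_hl oq qq sW.
have C1 := dform_vfields fgamma dX dY; have C2 := dform_vfields fbetaN dX dY.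
have gX V : (fun q' => gamma q' (hlift_field actN pi gN V q')) =
    (fun q' => betaN q' (hlift_field actN pi gN V q')).
  by apply/funext => q'; rewrite gammaE /hlift_field tmap_hl.
rewrite Xp Yp in C1 C2.
have D := cancel_derivatives C1 C2 (congr1 (fun F => dfun F p (hl p u)) (gX W))
  (congr1 (fun F => dfun F p (hl p w)) (gX U)).
apply: etrans D _.
have H := curvature_spec oq qq sU sW (fc u) (fc w) (p := p).
rewrite -/X -/Y in H *; set br := lie_bracket X Y p in H *.
set Om := Omega p u w in H *.
clearbody br Om.
have hE : hl p (tmap pi p br) = br - afieldN Om p.
  apply: etrans (congr1 (hl p) _) (hliftK pb gNr gNl gNpos H).
  rewrite -scaleN1r addrC (tmap_linear (smooth_pi pb p)).
  by rewrite (tmap_pi_action_field pb) scaler0 add0r.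
rewrite gammaE hE -(betaN_vertical p).
have B2 : betaN p (br - afieldN Om p) = -1 * betaN p (afieldN Om p) + betaN p br.
  rewrite addrC -scaleN1r; exact: fbetaN.1.
by rewrite B2; exact: sub_shift.
Qed.

Lemma is_form2_curvature_form : is_form2 curvature_form.
Proof.
have [bd dd] := is_form2_dform fAh; have [bgh _ _] := gh_metric.
split; first exact: bilinear_field_sub bd (is_bilinear_kahler bgh eAh).
move=> q u; rewrite /curvature_form dd; have [p <-] := pb_surjective pb q.
rewrite kahler_form_quotient /kahler_form; set x := tmap iota p _.
have [_ AA gA] := hA.
have E : g (iota p) (A (iota p) x) x = - g (iota p) (A (iota p) x) x.
  rewrite -{1}gA AA (scalarN _ (gl _ _)); congr (- _); exact: gsym.
have /eqP := E; rewrite -subr_eq0 opprK -mulr2n mulrn_eq0 /= => /eqP ->.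
exact: subrr.
Qed.

Lemma curvature_form_type11 (B : endo M) (Bh : endo Q) mu :
  almost_hermitian g B -> moment_map act (kahler_form g B) mu ->
  (forall p, exists Gam, levi_civita_at g p Gam /\ parallel_at B p Gam) ->
  induced_endo iota actN pi gN B Bh -> type11 Bh curvature_form.
Proof.
move=> hB mm par indB; apply: invariant_type11.
  by have [] := is_form2_curvature_form.
move=> q u v; have [p <-] := pb_surjective pb q.
rewrite !curvature_formE -!(betaN_vertical p).
by rewrite (curvature_invariant _ _ hB mm (par _) indB).
Qed.

End OneStructure.
End BasicForm.
End Quotient.

Theorem proposition4 (R : realType) (k n m l : nat) (G : lie_group R k)
  (M : manifold R n) (N : manifold R m) (Q : manifold R l)
  (g : form2 M) (I J K : endo M) (act : G -> M -> M)
  (muI muJ muK : M -> 'rV[R]_k -> R)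
  (iota : N -> M) (actN : G -> N -> N) (pi : N -> Q)
  (gh : form2 Q) (Ih Jh Kh : endo Q)
  (alpha : form1 M) (Jalpha_g Kalpha_g : 'rV[R]_k -> R)
  (M_hyperkahler : hyperkahler g I J K)
  (act_action : smooth_action act)
  (act_isometric : invariant_form2 act g)
  (act_I : invariant_endo act I)
  (act_J : invariant_endo act J)
  (act_K : invariant_endo act K)
  (muI_moment : moment_map act (kahler_form g I) muI)
  (muJ_moment : moment_map act (kahler_form g J) muJ)
  (muK_moment : moment_map act (kahler_form g K) muK)
  (Q_quotient : hyperkahler_quotient g I J K act muI muJ muK
                  iota actN pi gh Ih Jh Kh)
  (alpha_form : is_form1 alpha)
  (alpha_basic : basic_form1 act alpha)
  (alpha_closed : forall p u v, dform alpha p u v = 0)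
  (dJalpha : forall p u v,
     dform (endo_form1 J alpha) p u v = kahler_form g J p u v)
  (dKalpha : forall p u v,
     dform (endo_form1 K alpha) p u v = kahler_form g K p u v)
  (Jalpha_gE : forall Y (p : N),
     endo_form1 J alpha (iota p) (action_field act Y (iota p)) = Jalpha_g Y)
  (Kalpha_gE : forall Y (p : N),
     endo_form1 K alpha (iota p) (action_field act Y (iota p)) = Kalpha_g Y) :
  let Omega := curvature actN pi (pullback2 iota g) in
  exists (alphah : form1 Q) (F1 F2 : form2 Q),
    [/\ is_form1 alphah,
        (forall p v, pullback1 pi alphah p v = pullback1 iota alpha p v),
        is_form2 F1 & is_form2 F2] /\
    [/\ (forall q u v, dform alphah q u v = 0),
        (forall q u v, dform (endo_form1 Jh alphah) q u v =
                       kahler_form gh Jh q u v + F1 q u v) &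
        (forall q u v, dform (endo_form1 Kh alphah) q u v =
                       kahler_form gh Kh q u v + F2 q u v)] /\
    [/\ type11 Ih F1, type11 Jh F1 & type11 Kh F1] /\
    [/\ type11 Ih F2, type11 Jh F2 & type11 Kh F2] /\
    [/\ (forall p u v, F1 (pi p) u v = Jalpha_g (Omega p u v)) &
        (forall p u v, F2 (pi p) u v = Kalpha_g (Omega p u v))].
Proof.
move=> Omega; have hI := hk_I M_hyperkahler; have hJ := hk_J M_hyperkahler.
have hK := hk_K M_hyperkahler; have [_ _ eJh eKh] := hq_tensors Q_quotient.
have parI p : exists Gam, levi_civita_at g p Gam /\ parallel_at I p Gam.
  by have [Gam [lc [pI _ _]]] := hk_parallel M_hyperkahler p; exists Gam.
have parJ p : exists Gam, levi_civita_at g p Gam /\ parallel_at J p Gam.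
  by have [Gam [lc [_ pJ _]]] := hk_parallel M_hyperkahler p; exists Gam.
have parK p : exists Gam, levi_civita_at g p Gam /\ parallel_at K p Gam.
  by have [Gam [lc [_ _ pK]]] := hk_parallel M_hyperkahler p; exists Gam.
have indI := hq_I Q_quotient; have indJ := hq_J Q_quotient.
have indK := hq_K Q_quotient.
have FJE := curvature_formE M_hyperkahler act_action muI_moment Q_quotient
  alpha_form alpha_basic hJ eJh indJ dJalpha Jalpha_gE.
have FKE := curvature_formE M_hyperkahler act_action muI_moment Q_quotient
  alpha_form alpha_basic hK eKh indK dKalpha Kalpha_gE.
have TJ := @curvature_form_type11 _ _ _ _ _ _ _ _ _ _ _ _ _ _ _ _ _ _ _ _ _ _ _ _
  M_hyperkahler act_action muI_moment Q_quotient
  _ alpha_form alpha_basic _ _ _ hJ eJh indJ dJalpha Jalpha_gE.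
have TK := @curvature_form_type11 _ _ _ _ _ _ _ _ _ _ _ _ _ _ _ _ _ _ _ _ _ _ _ _
  M_hyperkahler act_action muI_moment Q_quotient
  _ alpha_form alpha_basic _ _ _ hK eKh indK dKalpha Kalpha_gE.
exists (descended_form Q_quotient alpha),
  (curvature_form Q_quotient alpha Jh), (curvature_form Q_quotient alpha Kh).
split; [split|split; [split|split; [split|split; split]]].
- exact: (is_form1_descended_form M_hyperkahler act_action Q_quotient
    alpha_form alpha_basic).
- exact: (descended_formE M_hyperkahler act_action Q_quotient
    alpha_form alpha_basic).
- exact: (is_form2_curvature_form M_hyperkahler act_action Q_quotient
    alpha_form alpha_basic hJ eJh indJ).
- exact: (is_form2_curvature_form M_hyperkahler act_action Q_quotient
    alpha_form alpha_basic hK eKh indK).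
- exact: (d_descended_form M_hyperkahler act_action Q_quotient
    alpha_form alpha_basic alpha_closed).
- by move=> q u v; rewrite /curvature_form addrC subrK.
- by move=> q u v; rewrite /curvature_form addrC subrK.
- exact: (TJ _ _ _ hI muI_moment parI indI).
- exact: (TJ _ _ _ hJ muJ_moment parJ indJ).
- exact: (TJ _ _ _ hK muK_moment parK indK).
- exact: (TK _ _ _ hI muI_moment parI indI).
- exact: (TK _ _ _ hJ muJ_moment parJ indJ).
- exact: (TK _ _ _ hK muK_moment parK indK).
- exact: FJE.
- exact: FKE.
Qed.
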